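(* Let $P\in \mathcal{P}_4^4$ be a polytope with its centroid at the origin. Then $$\frac{X_3(P)}{V_4(P)}\leq\sqrt[4]{\frac{72}{125}},$$ with equality if and only if $\mathrm{supp}\,S_P\cup\mathrm{supp}\,S_{-P}=\{\pm u_1,\dots,\pm u_5\}$ for some five pairwise non-parallel unit vectors $u_1,\dots,u_5$, and $V_P(\{\pm u_i\})=\frac{V_4(P)}{5}$ for $i=1,\dots,5$.
   Context: A polytope in $\mathbb{R}^n$ is the convex hull of a finite set of points; $\mathcal{P}_o^n$ denotes the set of polytopes in $\mathbb{R}^n$ with the origin $o$ in their interiors, and $V_n(P)$ is the $n$-dimensional volume of $P$. For a polytope $P\in\mathcal{P}_o^n$, $S_P$ is its surface area measure, so $\mathrm{supp}\,S_P$ is the finite set of unit outer normals of the facets of $P$, and $\mathrm{supp}\,S_{-P}=-\mathrm{supp}\,S_P$. If $u$ is a unit outer normal vector to a facet $F$ of $P\in\mathcal{P}_o^n$, the cone-volume $V_P(\{u\})$ is the volume of the convex hull of $o$ and $F$; $V_P(\{u\})=0$ if $u$ is not a facet normal of $P$; and $V_P(\{\pm u\})=V_P(\{u\})+V_P(\{-u\})$. $\mathcal{P}_4^4$ is the set of polytopes $P\in\mathcal{P}_o^4$ in $4$-general position, i.e. such that, writing $\mathrm{supp}\,S_P\cup\mathrm{supp}\,S_{-P}=\{\pm u_1,\dots,\pm u_N\}$ with $u_1,\dots,u_N$ pairwise non-parallel, any four elements of $\{u_1,\dots,u_N\}$ are linearly independent. Volume decomposition functionals: if $u_1,\dots,u_N$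 are the (distinct) unit outer normal vectors of the facets of $P\in\mathcal{P}_o^n$, then for $k\in\{1,\dots,n\}$ the number $X_k(P)\ge 0$ is defined by $$X_k(P)^{n}= \sum_{\dim (\mathrm{span}\{u_{i_1},\dots,u_{i_n}\})=k}V_P(\{u_{i_1}\})V_P(\{u_{i_2}\}) \cdots V_P(\{u_{i_n}\}),$$ where the sum is over all ordered $n$-tuples $(i_1,\dots,i_n)\in\{1,\dots,N\}^n$ (repetitions allowed) such that the linear span of $u_{i_1},\dots,u_{i_n}$ has dimension $k$. Here $n=4$, $k=3$. *)

(* Defs.v *)
From HB Require Import structures.
From mathcomp Require Import all_boot all_order all_algebra.
From mathcomp Require Import all_classical all_reals all_analysis.

Set Implicit Arguments.
Unset Strict Implicit.
Unset Printing Implicit Defensive.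
Import Order.TTheory GRing.Theory Num.Theory.
Import numFieldNormedType.Exports.
Local Open Scope classical_set_scope.
Local Open Scope ring_scope.

(* The Borel sigma-algebra on R^n = 'rV[R]_n, as the product sigma-algebra. *)
Section rV_measurable.
Variables (R : realType) (n : nat).

Let coord (i : 'I_n) (x : 'rV[R]_n) : measurableTypeR R := x ord0 i.

Let rV_set0 : g_sigma_preimage coord set0.
Proof. exact: sigma_algebra0. Qed.

Let rV_setC A : g_sigma_preimage coord A -> g_sigma_preimage coord (~` A).
Proof. exact: sigma_algebraC. Qed.

Let rV_bigcup (F : _^nat) : (forall i, g_sigma_preimage coord (F i)) ->
  g_sigma_preimage coord (\bigcup_i (F i)).
Proof. exact: sigma_algebra_bigcup. Qed.

HB.instance Definition _ := @isMeasurable.Build default_measure_display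
  'rV[R]_n (g_sigma_preimage coord) rV_set0 rV_setC rV_bigcup.

Lemma measurable_coord (i : 'I_n) :
  measurable_fun [set: 'rV[R]_n] (coord i).
Proof.
move=> _ Y mY; rewrite setTI; apply: sub_sigma_algebra => /=.
rewrite -bigcup_seq/=; exists i => /=; first by rewrite mem_index_enum.
by exists Y => //; rewrite setTI.
Qed.

Lemma measurable_fun_rVP d (T : measurableType d) (f : T -> 'rV[R]_n) :
  (forall i, measurable_fun [set: T] (coord i \o f)) ->
  measurable_fun [set: T] f.
Proof.
move=> mf _ A mA.
suff : g_sigma_preimage (fun i => coord i \o f) `<=` measurable.
  apply; rewrite g_sigma_preimage_comp.
  by exists A.
apply: smallest_sub; first exact: sigma_algebra_measurable.
move=> B; rewrite -bigcup_seq/= => -[i _ [C mC <-]].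
exact: mf.
Qed.

End rV_measurable.

Section lebesgue_rV_succ.
Variables (R : realType) (n : nat).
Variable mu : {sigma_finite_measure set 'rV[R]_n -> \bar R}.

Definition rV_cons (xy : measurableTypeR R * 'rV[R]_n) : 'rV[R]_n.+1 :=
  \row_i if unlift ord0 i is Some j then xy.2 ord0 j else xy.1.

Definition rV_uncons (v : 'rV[R]_n.+1) : measurableTypeR R * 'rV[R]_n :=
  (v ord0 ord0, \row_j v ord0 (lift ord0 j)).

Lemma rV_consK : cancel rV_cons rV_uncons.
Proof.
case=> x y; rewrite /rV_uncons mxE unlift_none; congr pair.
by apply/rowP => j; rewrite !mxE liftK.
Qed.

Lemma measurable_rV_cons : measurable_fun [set: _] rV_cons.
Proof.
apply: measurable_fun_rVP => i.
case: (unliftP ord0 i) => [j ->|->].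
  rewrite [X in measurable_fun _ X]
    (_ : _ = (fun x : 'rV[R]_n => x ord0 j) \o snd).
    by apply: measurableT_comp; [exact: measurable_coord|exact: measurable_snd].
  by apply/funext => xy /=; rewrite mxE liftK.
rewrite [X in measurable_fun _ X](_ : _ = fst); first exact: measurable_fst.
by apply/funext => xy /=; rewrite mxE unlift_none.
Qed.

Lemma measurable_rV_uncons : measurable_fun [set: _] rV_uncons.
Proof.
apply: measurable_fun_pair; first exact: measurable_coord.
apply: measurable_fun_rVP => i.
rewrite [X in measurable_fun _ X](_ : _ = (fun x : 'rV[R]_n.+1 => x ord0 (lift ord0 i))).
  exact: measurable_coord.
by apply/funext => v /=; rewrite mxE.
Qed.

Definition lebesgue_rV_succ : set 'rV[R]_n.+1 -> \bar R :=
  pushforward (@lebesgue_measure R \x mu)%E rV_cons.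

HB.instance Definition _ := Measure.copy lebesgue_rV_succ
  (measure_function_pushforward__canonical__measure_function_Measure
     (@lebesgue_measure R \x mu)%E measurable_rV_cons).

Let lebesgue_rV_succ_sigma_finite : sigma_finite setT lebesgue_rV_succ.
Proof.
have /sigma_finiteP[F [TF ndF Foo]] := sigma_finiteT (@lebesgue_measure R).
have /sigma_finiteP[G [TG ndG Goo]] := sigma_finiteT mu.
exists (fun k => rV_uncons @^-1` (F k `*` G k)).
  rewrite -preimage_bigcup (_ : \bigcup_i _ = setT) ?preimage_setT//.
  apply/seteqP; split=> // -[x y] _.
  have [k _ Fkx] : (\bigcup_i F i) x by rewrite -TF.
  have [l _ Gly] : (\bigcup_i G i) y by rewrite -TG.
  exists (maxn k l) => //; split=> /=.
  - by move: x Fkx; exact/subsetPset/ndF/leq_maxl.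
  - by move: y Gly; exact/subsetPset/ndG/leq_maxr.
move=> k; have [mF Fk_oo] := Foo k; have [mG Gk_oo] := Goo k; split.
  rewrite -[X in measurable X]setTI; apply: measurable_rV_uncons => //.
  exact: measurableX.
rewrite /lebesgue_rV_succ /pushforward -comp_preimage.
rewrite (_ : rV_uncons \o rV_cons = id) ?preimage_id; last exact/funext/rV_consK.
by rewrite product_measure1E// lte_mul_pinfty// ge0_fin_numE.
Qed.

HB.instance Definition _ := Measure_isSigmaFinite.Build _ _ _ lebesgue_rV_succ
  lebesgue_rV_succ_sigma_finite.

End lebesgue_rV_succ.

Fixpoint lebesgue_rV (R : realType) (n : nat) :
    {sigma_finite_measure set 'rV[R]_n -> \bar R} :=
  match n with
  | 0 => \d_(0 : 'rV[R]_0)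
  | n'.+1 => lebesgue_rV_succ (lebesgue_rV R n')
  end.

(* lebesgue_rV is characterized by its values on boxes. *)
Lemma lebesgue_rV_box (R : realType) (n : nat)
    (A : 'I_n -> set (measurableTypeR R)) : (forall i, measurable (A i)) ->
  lebesgue_rV R n [set x | forall i, A i (x ord0 i)] =
  (\prod_(i < n) lebesgue_measure (A i))%E.
Proof.
elim: n A => [|n IH] A mA /=.
  by rewrite big_ord0 diracE mem_set//= => -[].
have preE : @rV_cons R n @^-1` [set x | forall i, A i (x ord0 i)] =
    A ord0 `*` [set x : 'rV[R]_n | forall i, A (lift ord0 i) (x ord0 i)].
  apply/seteqP; split=> -[x y] /=.
    move=> h; split=> [|i]; first by have := h ord0; rewrite mxE unlift_none.
    by have := h (lift ord0 i); rewrite mxE liftK.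
  by move=> [hx hy] i; rewrite mxE; case: unliftP => [j ->|->].
rewrite big_ord_recl -IH// /lebesgue_rV_succ /pushforward preE.
rewrite product_measure1E//.
rewrite (_ : mkset _ = \big[setI/setT]_(i < n)
    ((fun x : 'rV[R]_n => x ord0 i) @^-1` A (lift ord0 i))).
  apply: bigsetI_measurable => i _; rewrite -[X in measurable X]setTI.
  exact: measurable_coord.
apply/seteqP; split=> x /=; first by move=> h; rewrite -bigcap_seq => i _; exact: h.
by rewrite -bigcap_seq => h i; apply: h; rewrite /= mem_index_enum.
Qed.

Section polytopes.
Variables (R : realType) (n : nat).
Implicit Types (x u v : 'rV[R]_n) (A P : set 'rV[R]_n).

Definition dot u v : R := \sum_(i < n) u ord0 i * v ord0 i.

(* The library norm on 'rV[R]_n is the sup norm. *)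
Definition enorm u : R := Num.sqrt (dot u u).

Definition nonparallel u v : Prop := \rank (col_mx u v) = 2.

Definition convex_hull A : set 'rV[R]_n :=
  smallest (@convex_set R 'rV[R]_n) A.

Definition polytope P : Prop :=
  exists2 A, finite_set A & P = convex_hull A.

Definition polytope_o P : Prop := polytope P /\ P° 0.

Definition opp_set P : set 'rV[R]_n := [set - x | x in P].

(* A contains k.+1 affinely independent points x, x + row 0 M, ... *)
Definition has_aff_indep A k : Prop :=
  exists x (M : 'M[R]_(k, n)),
    [/\ A x, forall i, A (x + row i M) & row_free M].

Definition has_aff_dim A k : Prop :=
  has_aff_indep A k /\ forall l, has_aff_indep A l -> (l <= k)%N.

Definition support_face P u : set 'rV[R]_n :=
  [set x | P x /\ forall y, P y -> dot y u <= dot x u].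

(* supp S_P *)
Definition facet_normals P : set 'rV[R]_n :=
  [set u | enorm u = 1 /\ has_aff_dim (support_face P u) n.-1].

Definition volume A : R := fine (lebesgue_rV R n A).

Definition centroid P : 'rV[R]_n :=
  \row_(i < n) ((\int[lebesgue_rV R n]_(x in P) x ord0 i) / volume P).

Definition cone_volume P u : R :=
  if `[< facet_normals P u >] then volume (convex_hull (0 |` support_face P u))
  else 0.

(* V_P({u, -u}) for u != 0 *)
Definition cone_volume_pm P u : R := cone_volume P u + cone_volume P (- u).

(* An ordered n-tuple of facet normals is the n x n matrix with these rows;
   the dimension of their span is its rank. The index set is finite when P is
   a polytope with nonempty interior. *)
Definition X_functional (k : nat) P : R :=
  (\sum_(U \in [set U : 'M[R]_n |
                  (forall i, facet_normals P (row i U)) /\ \rank U = k])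
     \prod_(i < n) cone_volume P (row i U)) `^ (n%:R^-1).

(* supp S_P `|` supp S_{-P} = {+-u_0, ..., +-u_(N-1)} with the u_i unit and
   pairwise non-parallel *)
Definition normal_lines P (N : nat) (u : 'I_N -> 'rV[R]_n) : Prop :=
  [/\ forall i, enorm (u i) = 1,
      forall i j, i != j -> nonparallel (u i) (u j) &
      facet_normals P `|` facet_normals (opp_set P) =
        [set v | exists i, v = u i \/ v = - u i]].

Definition general_position (k : nat) P : Prop :=
  exists (N : nat) (u : 'I_N -> 'rV[R]_n), normal_lines P u /\
    forall s : 'I_k -> 'I_N, injective s -> row_free (\matrix_(j < k) u (s j)).

End polytopes.

(* Main.v *)
(** Put a_i = V_P({+-u_i}) / V_4(P). By general position, four normals span a
   3-space exactly when they lie on three distinct lines (if there are at least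
   four lines), so (X_3 / V_4)^4 is at most
   12 * sum over i and over j < k, all distinct, of a_i^2 a_j a_k.  The cones
   over distinct facets lie in P and meet inside hyperplanes, hence
   sum_i a_i <= 1.  With the sum a_i + a_j fixed, the polynomial is affine in
   the product a_i a_j; depending on the sign of the slope one may merge a_i and
   a_j or move one of them to the mean, which reduces the problem to N equal
   weights, where the value is 6(N-1)(N-2)/N^3, maximal exactly at N = 5.
   In the equality case no a_i vanishes, because every facet cone has nonempty
   interior, so there are exactly five lines. *)
Require Import Defs.
From mathcomp Require Import all_boot all_order all_algebra.
From mathcomp Require Import all_classical all_reals all_analysis.
From mathcomp Require Import ring lra zify.
Set Implicit Arguments.
Unset Strict Implicit.
Unset Printing Implicit Defensive.
Import Order.TTheory GRing.Theory Num.Theory.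
Import numFieldNormedType.Exports.
Local Open Scope ring_scope.

(** * The polynomial inequality *)

Section ineq.
Variable R : realFieldType.
Implicit Types (s t : seq R) (x y : R).

Definition psum k s : R := \sum_(x <- s) x ^+ k.

(* The sum of [x ^+ 2 * y * z] over ordered triples of distinct entries of [s],
   expanded in power sums. *)
Definition sum211 s : R :=
  psum 2 s * psum 1 s ^+ 2 - psum 2 s ^+ 2 - psum 3 s * psum 1 s *+ 2
  + psum 4 s *+ 2.

Lemma psum_cons k x s : psum k (x :: s) = x ^+ k + psum k s.
Proof. by rewrite /psum big_cons. Qed.

Lemma perm_psum k s t : perm_eq s t -> psum k s = psum k t.
Proof. exact: perm_big. Qed.

Lemma perm_sum211 s t : perm_eq s t -> sum211 s = sum211 t.
Proof. by move=> st; rewrite /sum211 !(perm_psum _ st). Qed.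

Lemma psum_nseq k n x : psum k (nseq n x) = x ^+ k * n%:R.
Proof. by rewrite /psum big_nseq iter_addr_0 mulr_natr. Qed.

(** The coefficient of [x * y]. It depends on [x] and [y] only through [x + y], so it is unchanged
    when the pair is replaced by another pair of the same sum. *)
Definition slope211 t x y : R :=
  ((x + y + psum 1 t) * psum 1 t - (psum 1 t ^+ 2 - psum 2 t) *+ 2) *+ 2.

(* With [x + y] fixed, [sum211] is an affine function of [x * y]. *)
Lemma sum211_merge x y t :
  sum211 [:: x, y & t] = sum211 (x + y :: t) + x * y * slope211 t x y.
Proof. by rewrite /sum211 /slope211 !psum_cons; ring. Qed.

Lemma sum211_nseq n : (0 < n)%N ->
  sum211 (nseq n n%:R^-1) = (n%:R - 1) * (n%:R - 2%:R) / n%:R ^+ 3.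
Proof.
move=> n0; have n0' : n%:R != 0 :> R by rewrite pnatr_eq0 -lt0n.
by rewrite /sum211 !psum_nseq; field.
Qed.

(** The right side minus the left is [(n - 5) * q n / (125 * n ^ 3)]. The quadratic [q] is negative
    at 1, 2, 3, 4 and positive at all larger integers, so the product vanishes only at 5 and is
    positive elsewhere. *)
Lemma uniform_bound n : (0 < n)%N ->
  ((n%:R : R) - 1) * (n%:R - 2%:R) / n%:R ^+ 3 <= 12%:R / 125%:R
  ?= iff (n == 5%N).
Proof.
move=> n0; have n0' : 0 < n%:R :> R by rewrite ltr0n.
have n3 : 0 < n%:R ^+ 3 :> R by rewrite exprn_gt0.
pose q (m : R) := 12%:R * m ^+ 2 - 65%:R * m + 50%:R.
have key : 12%:R / 125%:R - (n%:R - 1) * (n%:R - 2%:R) / n%:R ^+ 3 =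
   (n%:R - 5%:R) * q n%:R / (n%:R ^+ 3 * 125%:R) :> R.
  by rewrite /q; field; rewrite gt_eqF.
have qpos : n != 5%N -> 0 < (n%:R - 5%:R) * q n%:R :> R.
  move=> n5; rewrite /q.
  have [n6|n6] := ltnP 5 n.
    have : 6%:R <= n%:R :> R by rewrite ler_nat.
    by move: (n%:R : R) => m m6; rewrite mulr_gt0//; nra.
  by case: n n0 n6 n5 {n0' n3 key q} => [|[|[|[|[|[|]]]]]]//= _ _ _; lra.
split; last first.
  rewrite eq_sym -subr_eq0 key.
  have [->|n5] := eqVneq n 5%N; first by rewrite subrr !mul0r eqxx.
  by apply/negbTE; rewrite gt_eqF// divr_gt0// ?qpos// mulr_gt0.
rewrite -subr_ge0 key.
have [->|n5] := eqVneq n 5%N; first by rewrite subrr !mul0r.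
by rewrite ltW// divr_gt0// ?qpos// mulr_gt0.
Qed.

(** The deviations from the mean sum to zero, so if none is negative, or none is positive, they all
    vanish. *)
Lemma exists_lt_gt_mean s (m : R) : psum 1 s = m *+ size s ->
  has (fun x => x != m) s -> has (< m) s && has (> m) s.
Proof.
move=> sm hs.
have sm0 : \sum_(x <- s) (x - m) = 0.
  rewrite sumrB big_const_seq count_predT iter_addr_0 -sm /psum.
  by rewrite (eq_bigr (fun x : R => x)) ?subrr// => x _; rewrite expr1.
case/hasP : (hs) => z zs zm.
apply/andP; split; apply: contraT => /hasPn h.
  have : \sum_(x <- s) (x - m) == 0 by rewrite sm0.
  rewrite big_seq psumr_eq0; last by move=> x xs; rewrite subr_ge0 leNgt; exact: h.
  by move/allP => /(_ z zs); rewrite zs/= subr_eq0 (negbTE zm).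
have : \sum_(x <- s) (m - x) == 0.
  by under eq_bigr do rewrite -opprB; rewrite sumrN sm0 oppr0.
rewrite big_seq psumr_eq0; last by move=> x xs; rewrite subr_ge0 leNgt; exact: h.
by move/allP => /(_ z zs); rewrite zs/= subr_eq0 eq_sym (negbTE zm).
Qed.

Lemma perm_pair (x y : R) s : x \in s -> y \in s -> x != y ->
  exists t, perm_eq s [:: x, y & t].
Proof.
move=> xs ys xy; exists (rem y (rem x s)).
rewrite (perm_trans (perm_to_rem xs))// perm_cons perm_to_rem//.
have : y \in x :: rem x s by rewrite -(perm_mem (perm_to_rem xs)).
by rewrite inE eq_sym (negbTE xy).
Qed.

(* Smoothing: take entries [x < mean < y]. If the slope in [x * y] is
   nonpositive, merge them into [x + y]; otherwise replace them by
   [mean, x + y - mean]. *)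
Lemma sum211_le s : all (> 0) s -> psum 1 s = 1 ->
  sum211 s <= 12%:R / 125%:R /\
  (sum211 s = 12%:R / 125%:R -> s = nseq 5 5%:R^-1).
Proof.
(* Outer induction on the length, which merging lowers; inner induction on the number of entries
   different from the mean, which moving an entry to the mean lowers at constant length. *)
have [n] := ubnP (size s); elim: n s => // n IHn s.
have [k] := ubnP (count (fun x => x != (size s)%:R^-1) s).
elim: k s => // k IHk s; rewrite ltnS => sk; rewrite ltnS => sn s0 s1.
have ss0 : (0 < size s)%N.
  by case: s s1 {sk sn s0} => //; rewrite /psum big_nil => /eqP; rewrite eq_sym oner_eq0.
pose m : R := (size s)%:R^-1.
have sm : psum 1 s = m *+ size s.
  by rewrite s1 -[RHS]mulr_natr mulVf// pnatr_eq0 -lt0n.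
have [hs|] := boolP (has (fun x => x != m) s); last first.
  rewrite -all_predC => /allP hs.
  have {hs} es : s = nseq (size s) m.
    by apply/all_pred1P/allP => x /hs/=; rewrite negbK.
  have [le eq] := uniform_bound ss0.
  rewrite es sum211_nseq//; split => // /eqP.
  by rewrite eq => /eqP s5; rewrite /m s5.
have /andP[/hasP[x xs xm] /hasP[y ys ym]] := exists_lt_gt_mean sm hs.
have xy : x != y by rewrite lt_eqF// (lt_trans xm ym).
have [t st] := perm_pair xs ys xy.
have ssz : size s = (size t).+2 by rewrite (perm_size st).
move: (s0); rewrite (perm_all _ st) /= => /and3P[x0 y0 t0].
have m0 : 0 < m by rewrite invr_gt0 ltr0n.
rewrite (perm_sum211 st) sum211_merge.
have p1 : x + y + psum 1 t = 1.
  by rewrite -s1 (perm_psum _ st) !psum_cons !expr1 addrA.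
have xy0 : 0 < x * y by rewrite mulr_gt0.
have [B|B] := leP (slope211 t x y) 0.
  have [le eq] : sum211 (x + y :: t) <= 12%:R / 125%:R /\
    (sum211 (x + y :: t) = 12%:R / 125%:R -> x + y :: t = nseq 5 5%:R^-1).
    apply: IHn; first by move: sn; rewrite ssz.
      by rewrite /= t0 addr_gt0.
    by rewrite psum_cons expr1.
  split; first by nra.
  move=> e.
  have e1 : sum211 (x + y :: t) = 12%:R / 125%:R by apply/eqP; rewrite eq_le le/=; nra.
  have [xy5 t5] := eq e1.
  (* Equality would make the merged list five entries [1/5], where the slope is [-8/25]; splitting
     [x + y] back into two positive entries then strictly lowers the value. *)
  have B0 : slope211 t x y < 0.
    by rewrite /slope211 xy5 (t5 : t = nseq 4 5%:R^-1) !psum_nseq; lra.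
  have : x * y * slope211 t x y < 0 by rewrite pmulr_rlt0.
  by move: e; rewrite e1 => /eqP; rewrite -subr_eq0 addrAC subrr add0r => /eqP ->; rewrite ltxx.
pose z := x + y - m.
have st' : (size [:: m, z & t] = size s)%N by rewrite ssz.
have zsum : m + z = x + y by rewrite /z addrC subrK.
have [le _] : sum211 [:: m, z & t] <= 12%:R / 125%:R /\
    (sum211 [:: m, z & t] = 12%:R / 125%:R -> [:: m, z & t] = nseq 5 5%:R^-1).
  apply: IHk; last 1 first.
  - by rewrite !psum_cons !expr1 addrA zsum.
  - rewrite st' -/m; apply: leq_trans sk.
    have /permP/(_ (fun x => x != m)) -> := st.
    by rewrite /= -/m eqxx (lt_eqF xm) (gt_eqF ym)/= add0n !ltnS leq_add2r leq_b1.
  - by rewrite st'.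
  - by rewrite /= t0 m0 !andbT /z subr_gt0 (lt_trans ym)// ltrDr.
have Bz : slope211 t m z = slope211 t x y by rewrite /slope211 zsum.
(* The product grows by [(m - x) * (y - m) > 0] and the slope is positive, so the increase is strict
   and equality cannot occur here. *)
have lt : sum211 (x + y :: t) + x * y * slope211 t x y < sum211 [:: m, z & t].
  rewrite sum211_merge zsum Bz ltrD2l ltr_pM2r// -subr_gt0.
  rewrite (_ : _ - _ = (m - x) * (y - m)); last by rewrite /z; ring.
  by rewrite mulr_gt0// subr_gt0.
split; first exact: ltW (lt_le_trans lt le).
by move=> e; move: (lt_le_trans lt le); rewrite e ltxx.
Qed.

End ineq.

(** * Sums over quadruples taking exactly three distinct values *)

Section three_distinct.
Variables (R : realFieldType) (I : finType).
Implicit Types (a : I -> R) (i j k l : I) (G : I -> I -> I -> I -> R).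

(** Turns sums over functions on ['I_4] into iterated sums, whose indices can be exchanged. As [p]
    is below 4, the default of [nth] is never returned. *)
Definition ffun4 (q : I * I * (I * I)) : {ffun 'I_4 -> I} :=
  [ffun p : 'I_4 => nth q.1.1 [:: q.1.1; q.1.2; q.2.1; q.2.2] p].

Lemma big_ffun4 (F : {ffun 'I_4 -> I} -> R) :
  \sum_s F s = \sum_i \sum_j \sum_k \sum_l F (ffun4 (i, j, (k, l))).
Proof.
pose o (p : nat) : 'I_4 := inord p.
rewrite (reindex ffun4) /=; last first.
  exists (fun s => (s (o 0), s (o 1), (s (o 2), s (o 3)))) => [[[i j] [k l]] _|s _].
    by rewrite !ffunE/= !inordK.
  apply/ffunP => p; rewrite ffunE /= /o.
  by case: p => -[|[|[|[|]]]]//= p; congr (s _); apply/val_inj; rewrite /= inordK.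
rewrite -(pair_big xpredT xpredT (fun x y => F (ffun4 (x, y)))) /=.
rewrite (pair_big_dep xpredT (fun _ => xpredT) (fun i j => \sum_k \sum_l F (ffun4 (i, j, (k, l))))) /=.
apply: eq_bigr => -[i j] _ /=.
by rewrite (pair_big xpredT xpredT (fun k l => F (ffun4 (i, j, (k, l))))); apply: eq_bigr => -[].
Qed.

Definition sum4 G := \sum_i \sum_j \sum_k \sum_l G i j k l.

Lemma eq_sum4 G H : (forall i j k l, G i j k l = H i j k l) -> sum4 G = sum4 H.
Proof.
move=> GH; apply: eq_bigr => i _; apply: eq_bigr => j _.
by apply: eq_bigr => k _; apply: eq_bigr.
Qed.

Lemma sum4D G H : sum4 (fun i j k l => G i j k l + H i j k l) = sum4 G + sum4 H.
Proof.
rewrite -big_split; apply: eq_bigr => i _ /=; rewrite -big_split; apply: eq_bigr => j _ /=.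
by rewrite -big_split; apply: eq_bigr => k _ /=; rewrite -big_split.
Qed.

Lemma sum4_swap12 G : sum4 G = sum4 (fun i j k l => G j i k l).
Proof. exact: exchange_big. Qed.

Lemma sum4_swap23 G : sum4 G = sum4 (fun i j k l => G i k j l).
Proof. by apply: eq_bigr => i _; exact: exchange_big. Qed.

Lemma sum4_swap34 G : sum4 G = sum4 (fun i j k l => G i j l k).
Proof. by apply: eq_bigr => i _; apply: eq_bigr => j _; exact: exchange_big. Qed.

Let delta i j : R := (i == j)%:R.

Lemma sum_delta i (F : I -> R) : \sum_j delta i j * F j = F i.
Proof.
rewrite (bigD1 i)//= /delta eqxx mul1r big1 ?addr0// => j ji.
by rewrite eq_sym (negbTE ji) mul0r.
Qed.

(** An indicator written as a polynomial in Kronecker deltas, so that counting coincidences becomes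
    ring arithmetic. *)
Let distinct i j k : R := (1 - delta i j) * (1 - delta i k) * (1 - delta j k).

Let deltaC i j : delta i j = delta j i.
Proof. by rewrite /delta eq_sym. Qed.

(** Any product of two of the deltas, and the product of all three, indicates [i = j = k]; this
    gives the coefficient [3 - 1 = 2]. *)
Lemma distinctE i j k : distinct i j k =
  1 - delta i j - delta i k - delta j k + delta i j * delta j k *+ 2.
Proof.
rewrite /distinct /delta.
have [ij|ij] := eqVneq i j; first by rewrite ij; case: (j == k) => /=; ring.
have [<-|jk] := eqVneq j k; first by rewrite (negbTE ij)/=; ring.
by case: (i == k) => /=; ring.
Qed.

(** Summing out [k] and then [j], each delta contracts an index and leaves power sums. *)
Lemma sum_distinct a :
  \sum_i \sum_j \sum_k distinct i j k * (a i * a j * a k ^+ 2) =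
  sum211 [seq a i | i <- enum I].
Proof.
have pE n : psum n [seq a i | i <- enum I] = \sum_i a i ^+ n.
  by rewrite /psum big_map big_enum.
rewrite /sum211 !pE.
have inner i j : \sum_k distinct i j k * (a i * a j * a k ^+ 2) =
    a i * a j * (\sum_k a k ^+ 2) - delta i j * (a i * a j * (\sum_k a k ^+ 2))
    - a i ^+ 3 * a j - a i * a j ^+ 3 + delta i j * (a i * a j ^+ 3 *+ 2).
  under eq_bigr => k _.
    rewrite distinctE.
    rewrite (_ : _ * _ = (a i * a j - delta i j * (a i * a j)) * a k ^+ 2
      - delta i k * (a i * a j * a k ^+ 2)
      - delta j k * (a i * a j * a k ^+ 2)
      + delta j k * (delta i j * (a i * a j * a k ^+ 2 *+ 2))); last by ring.
    over.
  by rewrite big_split/= !sumrB -mulr_sumr !sum_delta; ring.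
have inner2 i : \sum_j \sum_k distinct i j k * (a i * a j * a k ^+ 2) =
    a i * ((\sum_j a j) * (\sum_k a k ^+ 2)) - a i ^+ 2 * (\sum_k a k ^+ 2)
    - a i ^+ 3 * (\sum_j a j) - a i * (\sum_j a j ^+ 3) + a i ^+ 4 *+ 2.
  under eq_bigr => j _ do rewrite inner.
  by rewrite big_split/= !sumrB !sum_delta -!mulr_suml -!mulr_sumr; ring.
under eq_bigr => i _ do rewrite inner2.
rewrite big_split/= !sumrB -!mulr_suml -sumrMnl.
rewrite (eq_bigr (fun i => a i ^+ 1) (fun i _ => esym (expr1 (a i)))).
ring.
Qed.

(** An entry is counted when it differs from all later ones. *)
Lemma card_set4 i j k l : #|[set ffun4 (i, j, (k, l)) p | p : 'I_4]| =
  ((i \notin [:: j; k; l]) + (j \notin [:: k; l]) + (k != l) + 1)%N.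
Proof.
have -> : [set ffun4 (i, j, (k, l)) p | p : 'I_4] =
    i |: (j |: (k |: [set l])).
  apply/setP => x; rewrite !inE; apply/imsetP/idP.
    move=> [p _ ->]; rewrite ffunE/=.
    by case: p => -[|[|[|[|]]]]//= _; rewrite eqxx ?orbT.
  move=> /or4P[] /eqP ->.
  - by exists (inord 0) => //; rewrite ffunE inordK.
  - by exists (inord 1) => //; rewrite ffunE inordK.
  - by exists (inord 2) => //; rewrite ffunE inordK.
  - by exists (inord 3) => //; rewrite ffunE inordK.
by rewrite !cardsU1 cards1 !inE !addnA.
Qed.

(* Exactly three values occur iff exactly one of the six pairs coincides. *)
Lemma indic_card3 i j k l :
  (#|[set ffun4 (i, j, (k, l)) p | p : 'I_4]| == 3)%:R =
  delta i j * distinct i k l + delta i k * distinct i j l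
  + delta i l * distinct i j k + delta j k * distinct i j l
  + delta j l * distinct i j k + delta k l * distinct i j k :> R.
Proof.
rewrite card_set4 /distinct /delta !inE.
have [?|ij] := eqVneq i j; first subst j.
  have [?|ik] := eqVneq i k; first subst k.
    by rewrite ?eqxx; case: (i == l) => /=; ring.
  have [?|il] := eqVneq i l; first by subst l; rewrite ?eqxx ?(eq_sym k i) ?(negbTE ik)/=; ring.
  by case: (k == l) => /=; ring.
have [?|ik] := eqVneq i k; first subst k.
  rewrite ?(eq_sym j i) ?(negbTE ij).
  have [?|il] := eqVneq i l; first by subst l; rewrite ?(eq_sym j i) ?(negbTE ij) ?eqxx/=; ring.
  by case: (j == l) => /=; ring.
have [?|il] := eqVneq i l; first subst l.
  rewrite ?(eq_sym j i) ?(eq_sym k i) ?(negbTE ij) ?(negbTE ik).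
  by case: (j == k) => /=; ring.
have [?|jk] := eqVneq j k; first by subst k; case: (j == l) => /=; ring.
have [?|jl] := eqVneq j l; last by case: (k == l) => /=; ring.
by subst l; rewrite ?(eq_sym k j) (negbTE jk)/=; ring.
Qed.

(** The coinciding pair can occupy six positions. Exchanges of adjacent summation indices carry each
    of them to the last two places, where the sum is [sum211]. *)
Lemma sum_three_distinct a :
  \sum_(s : {ffun 'I_4 -> I} | #|[set s p | p : 'I_4]| == 3) \prod_p a (s p) =
  6%:R * sum211 [seq a i | i <- enum I].
Proof.
pose w i j k l := a i * a j * a k * a l.
pose S (h : I -> I -> I -> I -> R) := sum4 (fun i j k l => h i j k l * w i j k l).
have distC i j k : distinct i j k = distinct j i k.
  by rewrite /distinct (deltaC j i); ring.
have distC' i j k : distinct i j k = distinct i k j.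
  by rewrite /distinct (deltaC k j); ring.
have S6 : S (fun i j k l => delta k l * distinct i j k) = sum211 [seq a i | i <- enum I].
  rewrite -sum_distinct /S; apply: eq_bigr => i _; apply: eq_bigr => j _.
  apply: eq_bigr => k _; rewrite /w.
  by under eq_bigr do rewrite -!mulrA; rewrite sum_delta expr2 !mulrA.
have S5 : S (fun i j k l => delta j l * distinct i j k) = sum211 [seq a i | i <- enum I].
  rewrite -S6 /S [RHS]sum4_swap23; apply: eq_sum4 => i j k l.
  by rewrite distC' /w; ring.
have S4 : S (fun i j k l => delta j k * distinct i j l) = sum211 [seq a i | i <- enum I].
  by rewrite -S5 /S [RHS]sum4_swap34; apply: eq_sum4 => i j k l; rewrite /w; ring.
have S3 : S (fun i j k l => delta i l * distinct i j k) = sum211 [seq a i | i <- enum I].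
  rewrite -S5 /S [RHS]sum4_swap12; apply: eq_sum4 => i j k l.
  by rewrite distC /w; ring.
have S2 : S (fun i j k l => delta i k * distinct i j l) = sum211 [seq a i | i <- enum I].
  by rewrite -S3 /S [RHS]sum4_swap34; apply: eq_sum4 => i j k l; rewrite /w; ring.
have S1 : S (fun i j k l => delta i j * distinct i k l) = sum211 [seq a i | i <- enum I].
  by rewrite -S2 /S [RHS]sum4_swap23; apply: eq_sum4 => i j k l; rewrite /w; ring.
rewrite big_mkcond big_ffun4.
transitivity (S (fun i j k l => delta i j * distinct i k l + delta i k * distinct i j l
  + delta i l * distinct i j k + delta j k * distinct i j l
  + delta j l * distinct i j k + delta k l * distinct i j k)).
  apply: eq_sum4 => i j k l; rewrite -indic_card3.
  rewrite !big_ord_recl big_ord0 !ffunE/= /w mulr1 !mulrA.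
  by case: ifP; rewrite ?mul1r ?mul0r.
rewrite /S; under eq_sum4 => i j k l do rewrite !mulrDl.
by rewrite !sum4D -!/(S _) S1 S2 S3 S4 S5 S6; ring.
Qed.

End three_distinct.

(** * The bound for nonnegative weights of total at most [V] *)

Section three_distinct_bound.
Variables (R : realFieldType) (I : finType).
Implicit Types (a : I -> R) (V : R).

Definition three_distinct a : R :=
  \sum_(s : {ffun 'I_4 -> I} | #|[set s p | p : 'I_4]| == 3) \prod_p a (s p).

Lemma three_distinctZ c a :
  three_distinct (fun i => c * a i) = c ^+ 4 * three_distinct a.
Proof.
rewrite /three_distinct mulr_sumr; apply: eq_bigr => s _.
by rewrite big_split/= prodr_const card_ord.
Qed.

(** Zero entries contribute nothing at positive exponents, so nonnegative weights reduce to the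
    positive ones that [sum211_le] requires. *)
Lemma psum_pos k (s : seq R) : (0 < k)%N -> all (>= 0) s ->
  psum k [seq x <- s | 0 < x] = psum k s.
Proof.
move=> k0 /allP s0; rewrite /psum big_filter big_mkcond; apply: eq_big_seq => x xs.
have := s0 x xs; rewrite le_eqVlt.
case/predU1P => [<-|->//]; by rewrite ltxx expr0n gtn_eqF.
Qed.

(** The constant is [6 * 12/125]. Vanishing weights are discarded first; if all are positive nothing
    is discarded, and the five equal entries of the equality case are the whole family. *)
Lemma three_distinct_le1 a : (forall i, 0 <= a i) -> \sum_i a i = 1 ->
  three_distinct a <= 72%:R / 125%:R /\
  (three_distinct a = 72%:R / 125%:R -> (forall i, 0 < a i) ->
     #|I| = 5%N /\ forall i, a i = 5%:R^-1).
Proof.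
move=> a0 a1; pose s := [seq x <- [seq a i | i <- enum I] | 0 < x].
have s0 : all (>= 0) [seq a i | i <- enum I].
  by apply/allP => _ /mapP[i _ ->]; exact: a0.
have ss : sum211 s = sum211 [seq a i | i <- enum I].
  by rewrite /sum211 !psum_pos.
have s1 : psum 1 s = 1.
  by rewrite psum_pos// /psum big_map big_enum -[RHS]a1; apply: eq_bigr => i _; rewrite expr1.
rewrite /three_distinct sum_three_distinct -ss.
have [le eq] := sum211_le (filter_all _ _) s1.
split; first by move: le; rewrite -/s; lra.
move=> e apos; have {}eq : s = nseq 5 5%:R^-1 by apply: eq; rewrite -/s; lra.
have sE : s = [seq a i | i <- enum I].
  by apply/all_filterP/allP => _ /mapP[i _ ->]; exact: apos.
have sz : #|I| = 5%N by rewrite cardE -(size_map a) -sE eq size_nseq.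
split => // i.
have : a i \in s by rewrite sE map_f// mem_enum.
by rewrite eq mem_nseq => /andP[_ /eqP].
Qed.

(** Homogeneity of degree 4 reduces a positive total [t] to total 1. Since [t <= V], equality also
    forces [t = V]. *)
Lemma three_distinct_le a V : (forall i, 0 <= a i) -> 0 < V -> \sum_i a i <= V ->
  three_distinct a <= 72%:R / 125%:R * V ^+ 4 /\
  (three_distinct a = 72%:R / 125%:R * V ^+ 4 -> (forall i, 0 < a i) ->
     #|I| = 5%N /\ forall i, a i = V / 5%:R).
Proof.
move=> a0 V0; set t := \sum_i a i => tV.
have t0 : 0 <= t by apply: sumr_ge0.
have [te|tn0] := eqVneq t 0.
  have ae i : a i = 0.
    by move/eqP: te; rewrite psumr_eq0// => /allP/(_ i); rewrite mem_index_enum => /(_ isT)/eqP.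
  have -> : three_distinct a = 0.
    by rewrite /three_distinct big1// => s _; rewrite (bigD1 ord0)//= ae mul0r.
  have c0 : 0 < 72%:R / 125%:R * V ^+ 4 by rewrite mulr_gt0 ?exprn_gt0//; lra.
  by split => [|e]; [exact: ltW|move: c0; rewrite -e ltxx].
have {tn0}t0 : 0 < t by rewrite lt_neqAle eq_sym tn0.
have b0 i : 0 <= t^-1 * a i by rewrite mulr_ge0// invr_ge0 ltW.
have b1 : \sum_i t^-1 * a i = 1 by rewrite -mulr_sumr mulVf ?gt_eqF.
have [le eq] := three_distinct_le1 b0 b1.
rewrite three_distinctZ in le eq.
have t4 : 0 < t ^+ 4 by rewrite exprn_gt0.
have aE : three_distinct a = t ^+ 4 * (t^-1 ^+ 4 * three_distinct a).
  by rewrite mulrA -exprMn divff ?gt_eqF// expr1n mul1r.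
have tV4 : t ^+ 4 <= V ^+ 4 by rewrite lerXn2r// nnegrE ltW.
set f := t^-1 ^+ 4 * _ in le eq aE.
split; first by rewrite aE; nra.
move=> e apos.
have e4 : t ^+ 4 = V ^+ 4.
  apply/eqP; rewrite eq_le tV4/=.
  move: e; rewrite aE => e; nra.
have et : t = V.
  by apply/eqP; rewrite -(@eqrXn2 _ 4)// ?ltW//; apply/eqP.
have {}eq : #|I| = 5%N /\ forall i, t^-1 * a i = 5%:R^-1.
  apply: eq; last by move=> i; rewrite mulr_gt0// invr_gt0.
  have : t ^+ 4 * f = t ^+ 4 * (72%:R / 125%:R) by rewrite -aE e e4 mulrC.
  by move/mulfI; apply; rewrite gt_eqF.
case: eq => I5 eq; split=> // i.
by rewrite -(eq i) et mulrA divff ?gt_eqF// mul1r.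
Qed.

Lemma three_distinct_uniform V : #|I| = 5%N ->
  three_distinct (fun=> V / 5%:R) = 72%:R / 125%:R * V ^+ 4.
Proof.
move=> I5; rewrite /three_distinct (sum_three_distinct (fun=> V / 5%:R)).
have pE n : psum n [seq V / 5%:R | _ <- enum I] = (V / 5%:R) ^+ n * 5%:R.
  by rewrite /psum big_map big_enum sumr_const I5 mulr_natr.
by rewrite /sum211 !pE; field.
Qed.

(** Distributivity: signed tuples are grouped by their underlying lines, and a product of two-term
    sums expands into all choices of signs. *)
Lemma sum_ffun_pair_bool (w : I * bool -> R) (Q : pred {ffun 'I_4 -> I}) :
  \sum_(t : {ffun 'I_4 -> I * bool} | Q [ffun p => (t p).1]) \prod_p w (t p) =
  \sum_(s : {ffun 'I_4 -> I} | Q s) \prod_p (w (s p, false) + w (s p, true)).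
Proof.
rewrite (partition_big (fun t : {ffun 'I_4 -> I * bool} => [ffun p => (t p).1]) Q)//=.
apply: eq_bigr => s Qs.
under [RHS]eq_bigr => p _.
  rewrite (_ : _ + _ = \sum_(j : I * bool | j.1 == s p) w j); last first.
    rewrite (reindex (fun b : bool => (s p, b)))/=; last first.
      exists snd => [//|[i b]]; rewrite inE/= => /eqP ->//.
    by under eq_bigl do rewrite eqxx; rewrite big_bool addrC.
  over.
rewrite (bigA_distr_big_dep (fun p j => j.1 == s p) (fun _ j => w j)) /=.
apply: eq_bigl => t; apply/andP/familyP => [[_ /eqP ts] p|ts].
  by apply/eqP; rewrite -ts ffunE.
have -> : [ffun p => (t p).1] = s by apply/ffunP => p; rewrite ffunE; apply/eqP/ts.
by [].
Qed.

End three_distinct_bound.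

(** * Rank of a tuple of signed vectors against the number of lines it uses *)

Section signed_rows.
Variables (F : fieldType) (I : finType) (n : nat) (u : I -> 'rV[F]_n).
Implicit Types (t : {ffun 'I_4 -> I * bool}).

Definition signed_row (j : I * bool) : 'rV[F]_n := (-1) ^+ j.2 *: u j.1.

Definition signed_mx t : 'M[F]_(4, n) := \matrix_p signed_row (t p).

Lemma row_signed_mx t p : row p (signed_mx t) = signed_row (t p).
Proof. exact: rowK. Qed.

Definition line_set t : {set I} := [set (t p).1 | p : 'I_4].

Lemma row_sub_signed_mx t p : (u (t p).1 <= signed_mx t)%MS.
Proof.
have -> : u (t p).1 = (-1) ^+ (t p).2 *: row p (signed_mx t).
  by rewrite row_signed_mx /signed_row scalerA -signr_addb addbb scale1r.
exact: scalemx_sub (row_sub _ _).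
Qed.

(** Every row is, up to sign, one of the vectors [u i] with [i] in [line_set t]. *)
Lemma rank_signed_mx_le t : (\rank (signed_mx t) <= #|line_set t|)%N.
Proof.
pose B : 'M[F]_(#|line_set t|, n) := \matrix_q u (enum_val q).
apply: leq_trans (rank_leq_row B); apply/mxrankS/row_subP => p.
rewrite row_signed_mx; apply: scalemx_sub.
have tp : (t p).1 \in line_set t by apply/imsetP; exists p.
by rewrite -[u _](_ : row (enum_rank_in tp (t p).1) B = _) ?row_sub// rowK enum_rankK_in.
Qed.

Hypothesis u_free : forall s : 'I_4 -> I, injective s -> row_free (\matrix_p u (s p)).

(** Four lines for four rows make the choice of line injective, so general position applies. *)
Lemma rank_signed_mx_inj t : #|line_set t| = 4%N -> \rank (signed_mx t) = 4%N.
Proof.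
move=> t4; apply/eqP; rewrite eqn_leq rank_leq_row/=.
have inj : injective (fun p => (t p).1).
  have /imset_injP i : #|[set (t p).1 | p in [set: 'I_4]]| == #|[set: 'I_4]|.
    rewrite cardsT [X in _ == X]card_ord; apply/eqP; rewrite -[RHS]t4.
    by apply/eq_card => x; apply/imsetP/imsetP => -[p _ ->]; exists p.
  by move=> p q pq; apply: i; rewrite ?inE.
apply: leq_trans (eq_leq (esym (eqP (u_free inj)))) _; apply/mxrankS/row_subP => p; rewrite rowK.
exact: row_sub_signed_mx.
Qed.

Lemma card_line_set_of_rank3 t : \rank (signed_mx t) = 3%N -> #|line_set t| = 3%N.
Proof.
move=> r3; apply/eqP; rewrite eqn_leq -{2}r3 rank_signed_mx_le andbT leqNgt.
apply/negP => t4; have : #|line_set t| = 4%N.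
  by apply/eqP; rewrite eqn_leq t4 andbT (leq_trans (leq_imset_card _ _))// card_ord.
by move/rank_signed_mx_inj; rewrite r3.
Qed.

(** A fourth line [l] completes the three to an independent family, and adjoining one vector raises
    the rank by at most one. With fewer than four lines, [u_free] would be vacuous. *)
Lemma rank3_of_card_line_set t : (3 < #|I|)%N -> #|line_set t| = 3%N ->
  \rank (signed_mx t) = 3%N.
Proof.
move=> I4 t3; apply/eqP; rewrite eqn_leq; apply/andP; split.
  by apply: leq_trans (rank_signed_mx_le t) _; rewrite t3.
have /set0Pn[l] : ~: line_set t != finset.set0.
  by rewrite -card_gt0 -(ltn_add2l #|line_set t|) cardsC addn0 t3.
rewrite inE => lt; pose B := l |: line_set t.
have B4 : #|B| = 4%N by rewrite cardsU1 lt t3.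
pose s (q : 'I_4) := enum_val (cast_ord (esym B4) q).
have sinj : injective s by move=> p q /enum_val_inj /cast_ord_inj.
have : (\matrix_p u (s p) <= signed_mx t + u l)%MS.
  apply/row_subP => p; rewrite rowK.
  have := enum_valP (cast_ord (esym B4) p); rewrite -/(s p) inE => /orP[/set1P ->|].
    exact: addsmxSr.
  case/imsetP => q _ ->; apply: submx_trans (addsmxSl _ _); exact: row_sub_signed_mx.
move/mxrankS; rewrite (eqP (u_free sinj)) => h.
have := leq_trans h (mxrank_adds_leqif _ _).
have : (\rank (u l) <= 1)%N by exact: rank_leq_row.
lia.
Qed.

End signed_rows.

Local Open Scope classical_set_scope.
Local Open Scope ring_scope.

(** * Convex hulls, compactness and Lebesgue measure *)

Section convexity.
Variables (R : realType) (n : nat).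
Implicit Types (x y z : 'rV[R]_n) (A B C : set 'rV[R]_n) (t : R).

Lemma convex_setP A : @convex_set R 'rV[R]_n A <->
  (forall x y t, 0 <= t -> t <= 1 -> A x -> A y -> A (t *: x + (1 - t) *: y)).
Proof.
split=> [cA x y t t0 t1 Ax Ay|cA x y t].
  have := cA x y (Itv01 t0 t1).
  by rewrite !inE; apply.
by rewrite !inE => Ax Ay; apply: cA.
Qed.

Lemma convex_hull_convex A : @convex_set R 'rV[R]_n (convex_hull A).
Proof.
apply/convex_setP => x y t t0 t1 Ax Ay B [cB AB].
by move/convex_setP : (cB); apply=> //; [exact: Ax|exact: Ay].
Qed.

(** The explicit form of the convex hull of a point and a nonempty convex set. *)
Definition join x C : set 'rV[R]_n :=
  [set z | exists t, exists2 c, C c & [/\ 0 <= t, t <= 1 & z = t *: x + (1 - t) *: c]].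

Lemma join_convex x C : @convex_set R 'rV[R]_n C -> @convex_set R 'rV[R]_n (join x C).
Proof.
move=> /convex_setP cC; apply/convex_setP.
move=> _ _ l l0 l1 [t [c Cc [t0 t1 ->]]] [s [d Cd [s0 s1 ->]]].
(* The total weight on [C]. If it vanishes the point is [x]; otherwise [c] and [d] are averaged with
   their weights divided by [w]. *)
pose w := l * (1 - t) + (1 - l) * (1 - s).
have w0 : 0 <= w by rewrite addr_ge0// mulr_ge0// subr_ge0.
have w1 : w <= 1 by rewrite /w; nra.
have [we|wn] := eqVneq w 0.
  have e1 : l * (1 - t) = 0.
    apply/eqP; rewrite eq_le mulr_ge0 ?subr_ge0// andbT.
    by rewrite -we lerDl mulr_ge0// subr_ge0.
  have e2 : (1 - l) * (1 - s) = 0 by move: we; rewrite /w e1 add0r.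
  exists 1; exists c => //; split => //.
  rewrite !scalerDr !scalerA e1 e2 !scale0r subrr scale0r !addr0 -scalerDl.
  by congr (_ *: _); rewrite -[RHS](subr0) -we /w; ring.
exists (1 - w); exists ((l * (1 - t) / w) *: c + (1 - l * (1 - t) / w) *: d).
  have wp : 0 < w by rewrite lt_neqAle eq_sym wn.
  apply: cC => //; first by rewrite divr_ge0// mulr_ge0// subr_ge0.
  by rewrite ler_pdivrMr// mul1r lerDl mulr_ge0// subr_ge0.
split; [by rewrite subr_ge0|by rewrite gerBl|].
rewrite !scalerDr !scalerA addrACA -scalerDl; congr (_ *: _ + (_ *: _ + _ *: _)).
- by rewrite /w; ring.
- by field.
- by rewrite /w; field.
Qed.

Lemma convex_hull_setU1 x C : @convex_set R 'rV[R]_n C -> C !=set0 ->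
  convex_hull (x |` C) = join x C.
Proof.
move=> cC [c Cc]; apply/seteqP; split.
  apply: smallest_sub; first exact: join_convex.
  move=> z [->|Cz].
    by exists 1; exists c => //; split; rewrite ?ler01// subrr scale0r scale1r addr0.
  by exists 0; exists z => //; split; rewrite ?ler01// scale0r add0r subr0 scale1r.
move=> _ [t [d Cd [t0 t1 ->]]].
have /convex_setP := @convex_hull_convex (x |` C); apply => //.
  by apply: sub_gen_smallest; left.
by apply: sub_gen_smallest; right.
Qed.

Lemma convex_hull_setU1_hull x A :
  convex_hull (x |` A) = convex_hull (x |` convex_hull A).
Proof.
apply/seteqP; split; apply: smallest_sub; try exact: convex_hull_convex.
  move=> z [->|Az]; apply: sub_gen_smallest; [by left|right].
  exact: sub_gen_smallest.
move=> z [->|]; first by apply: sub_gen_smallest; left.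
apply: smallest_sub; first exact: convex_hull_convex.
by move=> y Ay; apply: sub_gen_smallest; right.
Qed.

Lemma join_compact x C : compact C -> compact (join x C).
Proof.
move=> cC.
pose f (tc : R * 'rV[R]_n) := tc.1 *: x + (1 - tc.1) *: tc.2.
have -> : join x C = f @` (`[0, 1]%classic `*` C).
  apply/seteqP; split=> [z [t [c Cc [t0 t1 ->]]]|_ [[t c] /= [tI Cc] <-]].
    by exists (t, c) => //; split=> //=; rewrite in_itv/= t0.
  by move: tI; rewrite in_itv/= => /andP[t0 t1]; exists t; exists c.
apply: continuous_compact; last by apply: compact_setX => //; exact: segment_compact.
apply: continuous_subspaceT => tc.
apply: cvgD; first by apply: cvgZr_tmp; exact: cvg_fst.
apply: cvgZ; last exact: cvg_snd.
by apply: cvgB; [exact: cvg_cst|exact: cvg_fst].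
Qed.

(** Points are added one at a time: each addition to a nonempty hull is a [join], the continuous
    image of a product of compact sets. *)
Lemma polytope_compact A : polytope A -> compact A.
Proof.
move=> [B /finite_seqP[s ->] ->]; elim: s => [|x s IH].
  rewrite set_nil (_ : convex_hull _ = set0); first exact: compact0.
  by apply/seteqP; split=> //; apply: smallest_sub.
have -> : [set` x :: s] = x |` [set` s].
  by apply/seteqP; split=> y /=; rewrite inE => /predU1P.
rewrite convex_hull_setU1_hull.
have [->|/set0P s0] := eqVneq (convex_hull [set` s]) set0.
  rewrite setU0 (_ : convex_hull _ = [set x]); first exact: compact_set1.
  apply: smallest_id; apply/convex_setP => _ _ t _ _ -> ->.
  by rewrite /= -scalerDl addrC subrK scale1r.
by rewrite convex_hull_setU1//; [exact: join_compact|exact: convex_hull_convex].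
Qed.

Lemma polytope_convex A : polytope A -> @convex_set R 'rV[R]_n A.
Proof. by move=> [B _ ->]; exact: convex_hull_convex. Qed.

Lemma dot_continuous y : continuous (fun x => dot x y).
Proof.
apply: continuous_big => [|i _ x]; first exact: add_continuous.
apply: (@continuousM _ _ (fun x : 'rV[R]_n => x ord0 i) (fun=> y ord0 i)).
  exact: coord_continuous.
exact: cst_continuous.
Qed.

End convexity.

(** * Borel sets, cubes and finiteness of the measure on compact sets *)

Section borel.
Variables (R : realType) (n : nat).
Implicit Types (x y z : 'rV[R]_n) (A B C : set 'rV[R]_n) (t : R).

Lemma measurable_box (B : 'I_n -> set (measurableTypeR R)) :
  (forall i, measurable (B i)) -> measurable [set x : 'rV[R]_n | forall i, B i (x ord0 i)].
Proof.
move=> mB; rewrite (_ : mkset _ = \big[setI/setT]_(i < n)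
    ((fun x : 'rV[R]_n => x ord0 i) @^-1` B i)).
  apply: bigsetI_measurable => i _; rewrite -[X in measurable X]setTI.
  exact: measurable_coord.
apply/seteqP; split=> x /=; first by move=> h; rewrite -bigcap_seq => i _; exact: h.
by rewrite -bigcap_seq => h i; apply: h; rewrite /= mem_index_enum.
Qed.

Definition cube x t : set 'rV[R]_n :=
  [set y : 'rV[R]_n | forall i, `]x ord0 i - t, x ord0 i + t[%classic (y ord0 i)].

Lemma measurable_cube x t : measurable (cube x t).
Proof.
by apply: (@measurable_box (fun i => `]x ord0 i - t, x ord0 i + t[%classic)) => i; exact: measurable_itv.
Qed.

Lemma cubeE x t : 0 < t -> cube x t = ball x t.
Proof.
move=> t0; apply/seteqP; split=> y.
  move=> xy; split => // i j; rewrite (ord1 i) -ball_normE /=.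
  by have := xy j; rewrite /= in_itv/= -ltr_distlC.
by move=> [_ xy] i; have := xy ord0 i; rewrite -ball_normE /= in_itv/= -ltr_distlC.
Qed.

Lemma lebesgue_rV_cube x t : 0 < t -> lebesgue_rV R n (cube x t) = ((t *+ 2) ^+ n)%:E.
Proof.
move=> t0; rewrite (@lebesgue_rV_box R n (fun i => `]x ord0 i - t, x ord0 i + t[%classic)).
  under eq_bigr => i _.
    rewrite lebesgue_measure_itv/= lte_fin ltrD2l (lt_trans _ t0) ?oppr_lt0//.
    rewrite -EFinD (_ : _ - _ = t *+ 2); last by rewrite mulr2n; ring.
    over.
  by rewrite prodEFin prodr_const card_ord.
by move=> i; exact: measurable_itv.
Qed.

(** The sigma-algebra is generated by coordinates, so the open set is written as the countable union
    of the cubes inside it with rational centre and radius [1 / (k + 1)]. *)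
Lemma open_measurable_rV A : open A -> measurable A.
Proof.
move=> oA.
pose F (q : 'rV[rat]_n * nat) :=
  let c := cube (map_mx ratr q.1) q.2.+1%:R^-1 in if `[< c `<=` A >] then c else set0.
have -> : A = \bigcup_q F q.
  apply/seteqP; split=> [x Ax|x [q _]]; last first.
    by rewrite /F/=; case: ifPn => // /asboolP; apply.
  have /nbhs_ballP[e /= e0 xeA] : nbhs x A by exact: open_nbhs_nbhs.
  (* Two radii must fit: one from [x] to the rational centre, one from the centre to a point of the
     cube. *)
  have [k ke] : exists k : nat, k.+1%:R^-1 *+ 2 <= e.
    have [k ke] := ltr_add_invr (divr_gt0 e0 (ltr0n R 2) : 0 < e / 2%:R).
    exists k; move: ke; rewrite add0r => ke; rewrite -[_ *+ 2]mulr_natr.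
    by rewrite -ler_pdivlMr// ltW.
  have d0 : 0 < k.+1%:R^-1 :> R by rewrite invr_gt0.
  have hq i : exists q : rat, ratr q \in `](x ord0 i - k.+1%:R^-1), (x ord0 i + k.+1%:R^-1)[.
    by apply: rat_in_itvoo; rewrite ltrD2l (lt_trans _ d0)// oppr_lt0.
  pose q : 'rV[rat]_n := \row_i projT1 (cid (hq i)).
  have qx i : `|x ord0 i - ratr (q ord0 i)| < k.+1%:R^-1.
    by rewrite /q mxE; case: cid => /= r; rewrite in_itv/= ltr_distlC.
  exists (q, k) => //; rewrite /F/=; case: ifPn => [_ i|/asboolPn[]].
    by rewrite /= mxE in_itv/= -ltr_distlC distrC qx.
  move=> y yq; apply: xeA; rewrite -cubeE// => i.
  rewrite /= in_itv/= -ltr_distlC.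
  have := yq i; rewrite /= mxE in_itv/= -ltr_distlC => yqi.
  apply: lt_le_trans ke; rewrite mulr2n.
  rewrite -(subrK (ratr (q ord0 i)) (x ord0 i)) -addrA.
  by rewrite (le_lt_trans (ler_normD _ _))// ltrD.
apply: countable_bigcupT_measurable; first exact: countableP.
by move=> q; rewrite /F/=; case: ifPn => _ //; exact: measurable_cube.
Qed.

Lemma compact_measurable_rV A : compact A -> measurable A.
Proof.
move=> cA; rewrite -[A]setCK; apply: measurableC; apply: open_measurable_rV.
by apply: closed_openC; apply: compact_closed => //; exact: norm_hausdorff.
Qed.

Lemma compact_lebesgue_lty A : compact A -> (lebesgue_rV R n A < +oo)%E.
Proof.
move=> cA; have [M [_ bA]] := compact_bounded cA.
have [N N0 MN] : exists2 N : R, 0 < N & M < N.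
  exists (`|M| + 1); first by rewrite ltr_wpDl.
  by apply: (le_lt_trans (ler_norm M)); rewrite ltrDl.
have AN : A `<=` cube 0 (N + 1).
  move=> x Ax; rewrite cubeE ?addr_gt0//.
  suff : ball_ (fun y : 'rV[R]_n => `|y|) 0 (N + 1) x by rewrite -mx_norm_ball.
  rewrite /ball_/= sub0r normrN.
  apply: le_lt_trans (_ : N < _); last by rewrite ltrDl.
  exact: (bA N).
apply: (@le_lt_trans _ _ (lebesgue_rV R n (cube 0 (N + 1)))).
  apply: le_measure => //; rewrite inE; last exact: measurable_cube.
  exact: compact_measurable_rV.
by rewrite lebesgue_rV_cube ?addr_gt0// ltry.
Qed.

Lemma interior_lebesgue_gt0 A x : measurable A -> nbhs x A ->
  (0 < lebesgue_rV R n A)%E.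
Proof.
move=> mA /nbhs_ballP[e /= e0 eA].
apply: (@lt_le_trans _ _ (lebesgue_rV R n (cube x e))).
  by rewrite lebesgue_rV_cube// lte_fin exprn_gt0// pmulrn_lgt0.
apply: le_measure => //; rewrite ?inE//; first exact: measurable_cube.
by rewrite cubeE.
Qed.

End borel.

(** By induction: removing [A i] from everything takes only null parts off the other sets, while [B]
    loses exactly the measure of [A i]. *)
Lemma sum_measure_le d (T : measurableType d) (R : realType)
    (mu : {measure set T -> \bar R}) (I : eqType) (s : seq I) (A : I -> set T) B :
  measurable B -> uniq s ->
  (forall i, i \in s -> measurable (A i) /\ A i `<=` B) ->
  {in s &, forall i j, i != j -> mu (A i `&` A j) = 0%E} ->
  (\sum_(i <- s) mu (A i) <= mu B)%E.
Proof.
elim: s A B => [|i s IH] A B mB; first by rewrite big_nil.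
move=> /= /andP[iNs us] AB A0.
have tl j : j \in s -> j \in i :: s by rewrite inE orbC => ->.
have [mAi AiB] := AB i (mem_head _ _).
rewrite big_cons (measureDI mu mB mAi) (setIidr AiB) addeC; apply: leeD2r.
apply: le_trans (IH (fun j => A j `\` A i) (B `\` A i) _ us _ _).
- rewrite [leLHS]big_seq [leRHS]big_seq; apply: lee_sum => j js.
  have [mAj _] := AB j (tl _ js).
  rewrite (measureDI mu mAj mAi) [X in (_ + X)%E](A0 _ _ (tl _ js) (mem_head _ _)) ?adde0//.
  by apply: contraNneq iNs => <-.
- exact: measurableD.
- move=> j js; have [mAj AjB] := AB j (tl _ js); split; first exact: measurableD.
  by move=> x [Ajx Aix]; split=> //; exact: AjB.
- move=> j k js ks jk; apply/eqP; rewrite eq_le measure_ge0 andbT.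
  rewrite -(A0 j k (tl _ js) (tl _ ks) jk).
  have [mAj _] := AB j (tl _ js); have [mAk _] := AB k (tl _ ks).
  by apply: le_measure; rewrite ?inE; [apply: measurableI; exact: measurableD|exact: measurableI|move=> x [[]] ? _ []].
Qed.

(** * Hyperplanes are null sets *)

Section hyperplane.
Variable R : realType.

Lemma closed_hyperplane n (w : 'rV[R]_n) (c : R) : closed [set x | dot x w = c].
Proof.
apply: (@preimage_closed _ _ (fun x => dot x w) [set c]); last exact: closed_eq.
by move=> x _; exact: dot_continuous.
Qed.

Lemma measurable_hyperplane n (w : 'rV[R]_n) (c : R) :
  measurable [set x | dot x w = c].
Proof.
rewrite -[X in measurable X]setCK; apply: measurableC; apply: open_measurable_rV.
apply: closed_openC; exact: closed_hyperplane.
Qed.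

Lemma dot_rV_cons n (xy : measurableTypeR R * 'rV[R]_n) (w : 'rV[R]_n.+1) :
  dot (rV_cons xy) w = xy.1 * w ord0 ord0 + dot xy.2 (\row_j w ord0 (lift ord0 j)).
Proof.
rewrite /dot big_ord_recl /rV_cons mxE unlift_none; congr (_ + _).
by apply: eq_bigr => i _; rewrite !mxE liftK.
Qed.

(** Slicing along the first coordinate: if the remaining part [w'] of [w] is nonzero, all slices are
    hyperplanes one dimension lower; otherwise the set is a single point times the whole space. *)
Lemma lebesgue_rV_hyperplane n (w : 'rV[R]_n) (c : R) : w != 0 ->
  lebesgue_rV R n [set x | dot x w = c] = 0%E.
Proof.
elim: n w c => [|n IH] w c w0; first by move: w0; rewrite [w]thinmx0 eqxx.
rewrite /= /lebesgue_rV_succ /pushforward.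
set w' := \row_j w ord0 (lift ord0 j).
have -> : @rV_cons R n @^-1` [set x | dot x w = c] =
   [set xy | xy.1 * w ord0 ord0 + dot xy.2 w' = c].
  by apply/seteqP; split=> xy /=; rewrite dot_rV_cons.
have [w'0|w'N] := eqVneq w' 0.
  have w00 : w ord0 ord0 != 0.
    apply: contra w0 => /eqP w00; apply/eqP/rowP => i; rewrite mxE.
    have [j ->|->//] := unliftP ord0 i.
    by move/rowP/(_ j) : w'0; rewrite !mxE.
  rewrite (_ : mkset _ = [set c / w ord0 ord0] `*` setT).
    rewrite product_measure1E//.
    (* The other factor may be infinite; the convention [0 * +oo = 0] applies. *)
    by rewrite [X in (X * _)%E]lebesgue_measure_set1 mul0e.
  have d0 (y : 'rV[R]_n) : dot y w' = 0.
    by rewrite w'0 /dot big1// => i _; rewrite mxE mulr0.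
  apply/seteqP; split=> [[x y]|[x y] [/= -> _]] /=; rewrite d0 addr0.
    by move=> <-; split=> //; rewrite mulfK.
  by rewrite mulfVK.
rewrite /product_measure1 integral0_eq// => x _ /=.
rewrite -[RHS](IH w' (c - x * w ord0 ord0) w'N); congr (lebesgue_rV R n _).
apply/seteqP; split=> y /=; rewrite /xsection/= inE/=.
  by move=> <-; rewrite addrC addKr.
by move=> ->; rewrite addrC subrK.
Qed.

End hyperplane.

(** * Cones over facets *)

Section facets.
Variables (R : realType) (m : nat).
Local Notation n := m.+1.
Variable P : set 'rV[R]_n.
Hypothesis P_o : polytope_o P.
Implicit Types (u v x y : 'rV[R]_n).

Let P_compact : compact P. Proof. by apply: polytope_compact; case: P_o. Qed.
Let P_convex : @convex_set R 'rV[R]_n P.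
Proof. by apply: polytope_convex; case: P_o. Qed.
Let P_nbhs : nbhs (0 : 'rV[R]_n) P. Proof. by case: P_o. Qed.
Let P0 : P 0. Proof. exact: nbhs_singleton. Qed.

Lemma dotDl x y u : dot (x + y) u = dot x u + dot y u.
Proof. by rewrite /dot -big_split; apply: eq_bigr => i _; rewrite mxE mulrDl. Qed.

Lemma dotDr x y u : dot u (x + y) = dot u x + dot u y.
Proof. by rewrite /dot -big_split; apply: eq_bigr => i _; rewrite mxE mulrDr. Qed.

Lemma dotZl (t : R) x u : dot (t *: x) u = t * dot x u.
Proof. by rewrite /dot mulr_sumr; apply: eq_bigr => i _; rewrite mxE mulrA. Qed.

Lemma dotZr (t : R) x u : dot u (t *: x) = t * dot u x.
Proof. by rewrite /dot mulr_sumr; apply: eq_bigr => i _; rewrite mxE mulrCA. Qed.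

Lemma dot_enorm1 u : enorm u = 1 -> dot u u = 1.
Proof.
rewrite /enorm => u1.
have u0 : 0 <= dot u u by apply: sumr_ge0 => i _; exact: sqr_ge0.
by rewrite -(sqr_sqrtr u0) u1 expr1n.
Qed.

(** As the origin is interior, [P] contains a small positive multiple of [u], and the face lies at
    least as far in direction [u]. *)
Lemma face_height_gt0 u x : enorm u = 1 -> support_face P u x -> 0 < dot x u.
Proof.
move=> /dot_enorm1 uu [_ xmax].
have /nbhs_ballP[e /= e0 eP] := P_nbhs.
(* The ball around the origin is a sup-norm ball, so the coordinates of [u] have to be bounded by
   its Euclidean norm. *)
have u1 i : `|u ord0 i| <= 1.
  rewrite -[leRHS]normr1 -ler_sqr ?nnegrE// !normr1 expr1n real_normK ?num_real//.
  rewrite -uu /dot (bigD1 i)//= -expr2 lerDl sumr_ge0// => j _; exact: sqr_ge0.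
have Pu : P ((e / 2) *: u).
  apply: eP; rewrite -cubeE// => i; rewrite /= !mxE in_itv/= -ltr_distlC sub0r normrN normrM.
  rewrite gtr0_norm ?divr_gt0//.
  by apply: le_lt_trans (_ : e / 2 < e); [rewrite ler_piMr// ltW// divr_gt0|lra].
by have := xmax _ Pu; rewrite dotZl uu mulr1; apply: lt_le_trans; rewrite divr_gt0.
Qed.

Lemma facet_nonempty u : facet_normals P u -> exists x, support_face P u x.
Proof. by move=> [_ [[x [M [Fx _ _]]] _]]; exists x. Qed.

Lemma support_faceE u x : support_face P u x ->
  support_face P u = P `&` [set y | dot y u = dot x u].
Proof.
move=> [Px xmax]; apply/seteqP; split=> [y [Py ymax]|y [Py /= yx]].
  by split=> //=; apply/eqP; rewrite eq_le xmax// ymax.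
by split=> // z Pz; rewrite yx; exact: xmax.
Qed.

Lemma support_face_convex u : @convex_set R 'rV[R]_n (support_face P u).
Proof.
apply/convex_setP => x y t t0 t1 [Px xmax] [Py ymax]; split.
  by have /convex_setP := P_convex; apply.
move=> z Pz; rewrite dotDl !dotZl.
have := xmax z Pz; have := ymax z Pz => ? ?; nra.
Qed.

Definition cone u := convex_hull (0 |` support_face P u).

Lemma coneE u : facet_normals P u -> cone u = join 0 (support_face P u).
Proof.
move=> /facet_nonempty uF; apply: convex_hull_setU1 => //.
exact: support_face_convex.
Qed.

Lemma cone_measurable u : facet_normals P u -> measurable (cone u).
Proof.
move=> Pu; rewrite coneE//.
suff cF : compact (support_face P u).
  exact: compact_measurable_rV (join_compact cF).
have [x Fx] := facet_nonempty Pu; rewrite (support_faceE Fx).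
by apply: compact_closedI => //; exact: closed_hyperplane.
Qed.

Lemma cone_sub u : cone u `<=` P.
Proof. by apply: smallest_sub => // x [->//|[]]. Qed.

(** On the cone over the facet of [u], the ratio of [dot z u] to the height of that facet is at
    least the same ratio for [v]. By symmetry the ratios agree on the intersection, which therefore
    lies in the hyperplane orthogonal to [w]. *)
Lemma cone_null u v : facet_normals P u -> facet_normals P v -> u != v ->
  lebesgue_rV R n (cone u `&` cone v) = 0%E.
Proof.
move=> Pu Pv uv.
have [x Fx] := facet_nonempty Pu; have [y Fy] := facet_nonempty Pv.
have hx := face_height_gt0 Pu.1 Fx; have hy := face_height_gt0 Pv.1 Fy.
pose w := (dot x u)^-1 *: u - (dot y v)^-1 *: v.
have w0 : w != 0.
  (* If [w = 0], comparing squared norms of the rescaled unit vectors gives equal heights, hence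
     [u = v]. *)
  rewrite subr_eq0; apply: contra uv => /eqP e.
  have uu := dot_enorm1 Pu.1; have vv := dot_enorm1 Pv.1.
  have : (dot x u)^-1 ^+ 2 = (dot y v)^-1 ^+ 2.
    have := congr2 (@dot R n) e e.
    by rewrite !dotZl !dotZr uu vv !mulr1 -!expr2.
  move/eqP; rewrite eqrXn2 ?invr_ge0 ?ltW// => /eqP xy.
  by move: e; rewrite xy => /scalerI ->//; rewrite gt_eqF// invr_gt0.
apply/eqP; rewrite eq_le measure_ge0 andbT -(lebesgue_rV_hyperplane 0 w0).
apply: le_measure; rewrite ?inE.
- by apply: measurableI; exact: cone_measurable.
- exact: measurable_hyperplane.
rewrite !coneE// => z [[t [c Fc [t0 t1 zt]]] [s [d Fd [s0 s1 zs]]]] /=.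
have cu : dot c u = dot x u by move: Fc; rewrite (support_faceE Fx) => -[].
have dv : dot d v = dot y v by move: Fd; rewrite (support_faceE Fy) => -[].
have cv : dot c v <= dot y v by apply: Fy.2; case: Fc.
have du : dot d u <= dot x u by apply: Fx.2; case: Fd.
move: zt zs; rewrite !scaler0 !add0r => zt zs.
have zu : dot z u = (1 - t) * dot x u by rewrite zt dotZl cu.
have zv : dot z v = (1 - s) * dot y v by rewrite zs dotZl dv.
have le1 : (1 - s) * dot y v <= (1 - t) * dot y v.
  by rewrite -zv zt dotZl ler_wpM2l// subr_ge0.
have le2 : (1 - t) * dot x u <= (1 - s) * dot x u.
  by rewrite -zu zs dotZl ler_wpM2l// subr_ge0.
rewrite ler_pM2r// in le1; rewrite ler_pM2r// in le2.
have st : 1 - t = 1 - s by apply/eqP; rewrite eq_le le1 le2.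
rewrite /w -(scaleN1r (_ *: v)) dotDr !dotZr zu zv st mulN1r mulrCA mulVf ?gt_eqF//.
by rewrite mulrCA mulVf ?gt_eqF// subrr.
Qed.

Lemma lebesgue_polytope_lty : (lebesgue_rV R n P < +oo)%E.
Proof. exact: compact_lebesgue_lty. Qed.

Lemma volume_polytope_gt0 : 0 < volume P.
Proof.
rewrite /volume fine_gt0// lebesgue_polytope_lty andbT.
by apply: (interior_lebesgue_gt0 _ P_nbhs); exact: compact_measurable_rV.
Qed.

Lemma cone_fin_num u : facet_normals P u -> lebesgue_rV R n (cone u) \is a fin_num.
Proof.
move=> Pu; rewrite ge0_fin_numE//; apply: le_lt_trans lebesgue_polytope_lty.
apply: le_measure; rewrite ?inE; [exact: cone_measurable|exact: compact_measurable_rV|].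
exact: cone_sub.
Qed.

Lemma cone_volume_ge0 u : 0 <= cone_volume P u.
Proof. by rewrite /cone_volume; case: ifPn => // _; rewrite fine_ge0. Qed.

(** Vectors that are not facet normals contribute 0 and are filtered out; the remaining cones lie in
    [P] and overlap in null sets. *)
Lemma sum_cone_volume_le (s : seq 'rV[R]_n) : uniq s ->
  \sum_(u <- s) cone_volume P u <= volume P.
Proof.
move=> us; rewrite /cone_volume -big_mkcond -big_filter.
set s' := [seq _ <- _ | _].
have s'P u : u \in s' -> facet_normals P u.
  by rewrite mem_filter => /andP[/asboolP].
rewrite -lee_fin [X in (_ <= X)%E]fineK; last first.
  by rewrite ge0_fin_numE// lebesgue_polytope_lty.
rewrite -sumEFin big_seq.
rewrite (eq_bigr (fun u => lebesgue_rV R n (cone u))); last first.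
  by move=> u us'; rewrite fineK//; apply/cone_fin_num/s'P.
rewrite -big_seq; apply: sum_measure_le; rewrite ?filter_uniq//.
- exact: compact_measurable_rV.
- by move=> u /s'P Pu; split; [exact: cone_measurable|exact: cone_sub].
- by move=> u v /s'P Pu /s'P Pv; exact: cone_null.
Qed.

Lemma convex_barycenter (C : set 'rV[R]_n) (I : eqType) (r : seq I) (c : I -> R)
    (v : I -> 'rV[R]_n) : @convex_set R 'rV[R]_n C -> r != [::] ->
  (forall i, 0 < c i) -> (forall i, C (v i)) ->
  C ((\sum_(i <- r) c i)^-1 *: \sum_(i <- r) c i *: v i).
Proof.
move=> /convex_setP cC; elim: r => // i [|j r] IH _ c0 Cv.
  by rewrite !big_seq1 scalerA mulVf ?gt_eqF// scale1r.
rewrite big_cons [X in _ *: X]big_cons.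
have {}IH := IH isT c0 Cv.
set t := \sum_(k <- j :: r) c k in IH *.
have t0 : 0 < t by rewrite /t big_cons ltr_wpDr// sumr_ge0// => k _; exact: ltW.
have ct0 : 0 < c i + t by rewrite addr_gt0.
have p0 : 0 <= c i / (c i + t) by rewrite divr_ge0// ltW.
have p1 : c i / (c i + t) <= 1 by rewrite ler_pdivrMr// mul1r lerDl ltW.
have := cC _ _ _ p0 p1 (Cv i) IH.
rewrite scalerA (_ : (1 - _) * t^-1 = (c i + t)^-1); last first.
  by field; rewrite !gt_eqF.
by rewrite mulrC -scalerA -scalerDr.
Qed.

Lemma dot_sum (I : Type) (r : seq I) (F : I -> 'rV[R]_n) u :
  dot (\sum_(i <- r) F i) u = \sum_(i <- r) dot (F i) u.
Proof.
apply: (big_morph (fun x => dot x u)); first by move=> x y; exact: dotDl.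
by rewrite /dot big1// => i _; rewrite mxE mul0r.
Qed.

Lemma dot_sumr (I : Type) (r : seq I) (F : I -> 'rV[R]_n) u :
  dot u (\sum_(i <- r) F i) = \sum_(i <- r) dot u (F i).
Proof.
apply: (big_morph (fun x => dot u x)); first by move=> x y; exact: dotDr.
by rewrite /dot big1// => i _; rewrite mxE mulr0.
Qed.

(* The rows of [B] are the vertices of a simplex in the facet; the cone contains
   the points with positive coordinates of sum less than 1 in that basis. *)
Lemma cone_nbhs u : facet_normals P u -> exists z : 'rV[R]_n, nbhs z (cone u).
Proof.
move=> Pu; have [_ [[x [M [Fx FM Mfree]]] _]] := Pu.
have hx := face_height_gt0 Pu.1 Fx.
have FE := support_faceE Fx.
pose B : 'M[R]_(1 + m, n) := col_mx x (M + const_mx 1 *m x).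
have rowB i : support_face P u (row i B).
  case: (split_ordP i) => j ->.
    by rewrite rowKu (_ : row j x = x)//; apply/rowP => k; rewrite !mxE (ord1 j).
  rewrite rowKd linearD/= row_mul (_ : row j (const_mx 1) *m x = x); last first.
    by apply/rowP => k; rewrite !mxE big_ord1 !mxE mul1r.
  by rewrite addrC; exact: FM.
have rowBu i : dot (row i B) u = dot x u by have := rowB i; rewrite FE => -[].
have Bfree : row_free B.
  (* All rows have the same positive height over [u], so pairing a relation with [u] makes its
     coefficients sum to zero. The multiples of [x] then cancel, leaving a relation among the rows
     of [M]. *)
  apply: inj_row_free => v vB.
  have sv : \sum_i v ord0 i = 0.
    have /eqP : dot (v *m B) u = 0 by rewrite vB /dot big1// => i _; rewrite mxE mul0r.
    rewrite mulmx_sum_row dot_sum (eq_bigr (fun i => v ord0 i * dot x u)); last first.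
      by move=> i _; rewrite dotZl rowBu.
    by rewrite -mulr_suml mulf_eq0 (gt_eqF hx) orbF => /eqP.
  move: vB sv; rewrite -(hsubmxK v); set a := lsubmx v; set b := rsubmx v.
  rewrite /B mul_row_col mulmxDr mulmxA addrCA -mulmxDl => vB sv.
  have ab : a + b *m const_mx 1 = 0.
    apply/rowP => i; rewrite (ord1 i) mxE [RHS]mxE -[RHS]sv big_split_ord/= big_ord1.
    rewrite row_mxEl; congr (_ + _); rewrite mxE.
    by apply: eq_bigr => j _; rewrite row_mxEr !mxE mulr1.
  move: vB; rewrite ab mul0mx addr0 => /eqP.
  rewrite mulmx_free_eq0// => /eqP b0.
  by move: ab; rewrite b0 mul0mx addr0 => ->; rewrite row_mx0.
have [D BD] := row_freeP Bfree.
have DB : D *m B = 1%:M by apply: (@mulmx1C _ n B D).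
(* The dual basis: [dot z (d i)] is the [i]-th coordinate of [z] in the basis of rows of [B]. *)
pose d i := \row_j D j i : 'rV[R]_n.
have dE z i : dot z (d i) = (z *m D) ord0 i.
  by rewrite !mxE; apply: eq_bigr => j _; rewrite mxE.
(* There are [n] coordinates equal to [1 / (n + 1)], so they are positive with sum below 1; both
   conditions are open. *)
pose y : 'rV[R]_(1 + m) := const_mx n.+1%:R^-1.
exists (y *m B).
have yd i : dot (y *m B) (d i) = n.+1%:R^-1.
  by rewrite dE -mulmxA BD mulmx1 mxE.
have ys : dot (y *m B) (\sum_i d i) < 1.
  rewrite dot_sumr (eq_bigr _ (fun i _ => yd i)) sumr_const card_ord -[ltLHS]mulr_natr mulrC.
  by rewrite ltr_pdivrMr// mul1r ltr_nat.
have near_pos : \forall z \near y *m B, forall i, 0 < dot z (d i).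
  apply: (@filter_forall _ 'I_(1 + m) (fun i z => 0 < dot z (d i)) (nbhs (y *m B)) _) => i; apply: (cvgr_gt (dot (y *m B) (d i))).
    exact: dot_continuous.
  by rewrite yd invr_gt0.
have near_lt : \forall z \near y *m B, dot z (\sum_i d i) < 1.
  have cd := @dot_continuous R n (\sum_i d i) (y *m B).
  exact: (cvgr_lt _ cd).
apply: filterS2 near_pos near_lt => z zpos zlt.
(* The weight missing from 1 goes to the apex; the facet point is the normalised combination of the
   rows. *)
rewrite coneE//; exists (1 - \sum_i dot z (d i)).
exists ((\sum_i dot z (d i))^-1 *: \sum_i dot z (d i) *: row i B).
  apply: convex_barycenter => //; first exact: support_face_convex.
  by apply/eqP => e; have := mem_index_enum (ord0 : 'I_(1 + m)); rewrite e.
have s0 : 0 < \sum_i dot z (d i).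
  by rewrite (bigD1 ord0)//= ltr_pwDl// sumr_ge0// => i _; exact: ltW.
rewrite dot_sumr in zlt; split.
- by rewrite subr_ge0 ltW.
- by rewrite gerBl ltW.
rewrite scaler0 add0r opprB addrCA subrr addr0 scalerA divff ?gt_eqF// scale1r.
rewrite -[LHS]mulmx1 -DB mulmxA mulmx_sum_row.
by apply: eq_bigr => i _; rewrite dE.
Qed.

Lemma cone_volume_gt0 u : facet_normals P u -> 0 < cone_volume P u.
Proof.
move=> Pu; rewrite /cone_volume asboolT// /volume -/(cone u) fine_gt0//.
have [z zu] := cone_nbhs Pu.
rewrite (interior_lebesgue_gt0 (cone_measurable Pu) zu)/=.
by rewrite -ge0_fin_numE// cone_fin_num.
Qed.

End facets.

(** * Facet normals of the reflected polytope *)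

Section opposite.
Variables (R : realType) (n : nat).
Implicit Types (A : set 'rV[R]_n) (u : 'rV[R]_n).

Lemma opp_setK A : opp_set (opp_set A) = A.
Proof.
apply/seteqP; split=> [_ [_ [x Ax <-] <-]|x Ax]; first by rewrite opprK.
by exists (- x); rewrite ?opprK//; exists x.
Qed.

Lemma has_aff_indep_opp A k : has_aff_indep A k -> has_aff_indep (opp_set A) k.
Proof.
move=> [x [M [Ax AM Mfree]]]; exists (- x); exists (- M); split.
- by exists x.
- by move=> i; exists (x + row i M) => //; rewrite opprD linearN.
- by rewrite /row_free mxrank_opp.
Qed.

Lemma has_aff_dim_opp A k : has_aff_dim A k -> has_aff_dim (opp_set A) k.
Proof.
move=> [Ak maxk]; split; first exact: has_aff_indep_opp.
by move=> l /has_aff_indep_opp; rewrite opp_setK; exact: maxk.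
Qed.

Lemma enormN u : enorm (- u) = enorm u.
Proof. by rewrite /enorm /dot; congr Num.sqrt; apply: eq_bigr => i _; rewrite !mxE mulrNN. Qed.

Lemma support_face_opp A u : support_face (opp_set A) u = opp_set (support_face A (- u)).
Proof.
have dN x v : dot (- x) v = dot x (- v).
  by apply: eq_bigr => i _; rewrite !mxE mulrN mulNr.
apply/seteqP; split=> [_ [[x Ax <-] xmax]|_ [x [Ax xmax] <-]].
  exists x => //; split=> // y Ay; rewrite -!dN; apply: xmax.
  by exists y.
by split; [exists x|move=> _ [y Ay <-]; rewrite !dN; exact: xmax].
Qed.

Lemma facet_normals_opp A u : facet_normals (opp_set A) u -> facet_normals A (- u).
Proof.
move=> [u1]; rewrite support_face_opp => /has_aff_dim_opp; rewrite opp_setK => uF.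
by split; rewrite ?enormN.
Qed.

End opposite.

(** * The functional [X_functional 3] *)

Section normal_lines.
Variables (R : realType) (m N : nat) (P : set 'rV[R]_m.+1) (u : 'I_N -> 'rV[R]_m.+1).
Hypotheses (P_o : polytope_o P) (Pu : normal_lines P u).

(** Non-parallel vectors are never equal up to sign, and a unit vector differs from its opposite. *)
Lemma signed_row_inj : injective (signed_row u).
Proof.
have [u1 upar _] := Pu.
move=> [i b] [j c]; rewrite /signed_row/= => e.
have ui : u i = ((-1) ^+ b * (-1) ^+ c) *: u j.
  by rewrite -scalerA -e scalerA -signr_addb addbb scale1r.
have [ij|/upar] := eqVneq i j; last first.
  rewrite /nonparallel ui => r2.
  have : (col_mx (((-1) ^+ b * (-1) ^+ c) *: u j) (u j) <= u j)%MS.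
    by rewrite col_mx_sub submx_refl scalemx_sub.
  by move/mxrankS; rewrite r2 => /leq_trans/(_ (rank_leq_row _)).
subst j; congr pair.
move: ui; rewrite -signr_addb; have [//|bc] := eqVneq b c.
have -> : b (+) c by case: b c bc {e} => -[].
rewrite expr1 scaleN1r => /eqP; rewrite -subr_eq0 opprK -mulr2n.
rewrite -scaler_nat scaler_eq0 pnatr_eq0/= => /eqP ui; have := u1 i; rewrite ui /enorm /dot big1 ?sqrtr0.
  by move/eqP; rewrite eq_sym oner_eq0.
by move=> k _; rewrite mxE mul0r.
Qed.

Lemma signed_rowP v : (exists j, v = signed_row u j) <->
  (facet_normals P `|` facet_normals (opp_set P)) v.
Proof.
have [_ _ ->] := Pu; split=> [[[i b] ->]|[i [->|->]]].
- by exists i; rewrite /signed_row; case: b; [right|left]; rewrite /= ?expr1 ?expr0 ?scaleN1r ?scale1r.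
- by exists (i, false); rewrite /signed_row expr0 scale1r.
- by exists (i, true); rewrite /signed_row expr1 scaleN1r.
Qed.

Lemma cone_volume_pmE i :
  cone_volume_pm P (u i) = cone_volume P (signed_row u (i, false))
    + cone_volume P (signed_row u (i, true)).
Proof. by rewrite /signed_row/= expr0 expr1 scale1r scaleN1r. Qed.

Lemma cone_volume_pm_ge0 i : 0 <= cone_volume_pm P (u i).
Proof. by rewrite addr_ge0// cone_volume_ge0. Qed.

(** At least one of [u i] and [- u i] is a facet normal of [P], and its cone has nonempty
    interior. *)
Lemma cone_volume_pm_gt0 i : 0 < cone_volume_pm P (u i).
Proof.
have [/(cone_volume_gt0 P_o) h|/facet_normals_opp/(cone_volume_gt0 P_o) h] :
    (facet_normals P `|` facet_normals (opp_set P)) (u i).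
- by apply/signed_rowP; exists (i, false); rewrite /signed_row expr0 scale1r.
- by rewrite ltr_wpDr// cone_volume_ge0.
- by rewrite ltr_wpDl// cone_volume_ge0.
Qed.

Lemma sum_cone_volume_pm_le : \sum_i cone_volume_pm P (u i) <= volume P.
Proof.
have us : uniq [seq signed_row u j | j <- index_enum ('I_N * bool)%type].
  by rewrite map_inj_uniq ?index_enum_uniq//; exact: signed_row_inj.
apply: le_trans (sum_cone_volume_le P_o us).
rewrite big_map (eq_bigr (fun j => cone_volume P (signed_row u (j.1, j.2)))); last by case.
rewrite -(pair_big xpredT xpredT (fun i b => cone_volume P (signed_row u (i, b))))/=.
by apply: ler_sum => i _; rewrite big_bool [leRHS]addrC cone_volume_pmE.
Qed.

End normal_lines.

Lemma fsbig_pred (R : nmodType) (I : finType) (Q : pred I) (F : I -> R) :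
  \sum_(i \in [set` Q]) F i = \sum_(i | Q i) F i.
Proof.
by rewrite -(@bigfs _ _ _ _ (index_enum I)) ?index_enum_uniq// => i; rewrite mem_index_enum.
Qed.

Section X3.
Variables (R : realType) (N : nat) (P : set 'rV[R]_4) (u : 'I_N -> 'rV[R]_4).
Hypotheses (P_o : polytope_o P) (Pu : normal_lines P u).

Definition X3_sum : R :=
  \sum_(t : {ffun 'I_4 -> 'I_N * bool} | \rank (signed_mx u t) == 3)
     \prod_p cone_volume P (signed_row u (t p)).

(** Tuples of facet normals are reindexed by lines and signs. The extra signed tuples contain a
    vector that is not a facet normal, so their product vanishes. *)
Lemma X_functionalE : X_functional 3 P = X3_sum `^ 4%:R^-1.
Proof.
rewrite /X_functional; congr (_ `^ _).
pose f (U : 'M[R]_4) := \prod_(i < 4) cone_volume P (row i U).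
pose T := [set` (fun t : {ffun 'I_4 -> 'I_N * bool} => \rank (signed_mx u t) == 3)].
rewrite (@fsbig_widen _ _ _ _ _ (signed_mx u @` T)); first last.
- move=> U [[t /eqP tT <-]] /= UN.
  have [p Np] : exists p, ~ facet_normals P (row p (signed_mx u t)).
    by apply/existsNP => h; apply: UN; split.
  by rewrite (bigD1 p)//= {1}/cone_volume asboolF// mul0r.
- move=> U /= [UP U3].
  have /choice[t tE] : forall p, exists j, row p U = signed_row u j.
    by move=> p; apply/(signed_rowP Pu); left.
  have UE : signed_mx u [ffun p => t p] = U.
    by apply/row_matrixP => p; rewrite row_signed_mx ffunE tE.
  by exists [ffun p => t p] => //; apply/eqP; rewrite UE.
rewrite (@reindex_fsbig _ _ _ _ _ (signed_mx u) T); last first.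
  split; [by move=> t tT; exists t| |by []].
  move=> s t _ _ st; apply/ffunP => p; apply: (signed_row_inj Pu).
  by have := congr1 (row p) st; rewrite !row_signed_mx.
apply: etrans (fsbig_pred _ (fun t => f (signed_mx u t))) _.
by apply: eq_bigr => t _; apply: eq_bigr => p _; rewrite row_signed_mx.
Qed.

Lemma three_distinctE : three_distinct (fun i => cone_volume_pm P (u i)) =
  \sum_(t : {ffun 'I_4 -> 'I_N * bool} | #|line_set t| == 3)
    \prod_p cone_volume P (signed_row u (t p)).
Proof.
rewrite /three_distinct.
under eq_bigr do under eq_bigr do rewrite cone_volume_pmE.
rewrite -(sum_ffun_pair_bool (fun j => cone_volume P (signed_row u j))
  (fun s => #|[set s p | p : 'I_4]%SET| == 3)).
apply: eq_bigl => t; congr (_ == _); apply: eq_card => i.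
by apply/imsetP/imsetP => -[p _ ->]; exists p => //; rewrite ffunE.
Qed.

Hypothesis u_free : forall s : 'I_4 -> 'I_N, injective s -> row_free (\matrix_p u (s p)).

Lemma X3_sum_ge0 : 0 <= X3_sum.
Proof. by apply: sumr_ge0 => t _; apply: prodr_ge0 => p _; exact: cone_volume_ge0. Qed.

(** Rank 3 forces exactly three lines, and the additional terms on the right are nonnegative. *)
Lemma X3_sum_le : X3_sum <= three_distinct (fun i => cone_volume_pm P (u i)).
Proof.
rewrite three_distinctE /X3_sum big_mkcond [leRHS]big_mkcond.
apply: ler_sum => t _; case: ifPn => [/eqP /(card_line_set_of_rank3 u_free) ->//|_].
by case: ifPn => // _; apply: prodr_ge0 => p _; exact: cone_volume_ge0.
Qed.

Lemma X3_sum_eq : (3 < N)%N ->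
  X3_sum = three_distinct (fun i => cone_volume_pm P (u i)).
Proof.
move=> N3; rewrite three_distinctE; apply: eq_bigl => t.
apply/eqP/eqP => [/(card_line_set_of_rank3 u_free)//|].
by apply: rank3_of_card_line_set => //; rewrite card_ord.
Qed.

End X3.

(** * The inequality and its equality case *)

Lemma root4K (R : realType) (x : R) : 0 <= x -> (x `^ 4%:R^-1) ^+ 4 = x.
Proof.
by move=> x0; rewrite -powR_mulrn ?powR_ge0// -powRrM mulVf ?pnatr_eq0// powRr1.
Qed.

(** Both families of signed rows list the same set of normals without repetition, so
    [2 * N = 2 * N']. *)
Lemma normal_lines_card (R : realType) (m N N' : nat) (P : set 'rV[R]_m.+1)
    (u : 'I_N -> 'rV[R]_m.+1) (u' : 'I_N' -> 'rV[R]_m.+1) :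
  normal_lines P u -> normal_lines P u' -> N = N'.
Proof.
move=> Pu Pu'.
have us : uniq [seq signed_row u j | j <- enum {: 'I_N * bool}].
  by rewrite map_inj_uniq ?enum_uniq//; exact: signed_row_inj Pu.
have us' : uniq [seq signed_row u' j | j <- enum {: 'I_N' * bool}].
  by rewrite map_inj_uniq ?enum_uniq//; exact: signed_row_inj Pu'.
have : perm_eq [seq signed_row u j | j <- enum {: 'I_N * bool}]
    [seq signed_row u' j | j <- enum {: 'I_N' * bool}].
  apply: uniq_perm => // v; apply/mapP/mapP => -[j _ vj].
    have /(signed_rowP Pu)/(signed_rowP Pu')[k vk] : exists j, v = signed_row u j by exists j.
    by exists k => //; rewrite mem_enum.
  have /(signed_rowP Pu')/(signed_rowP Pu)[k vk] : exists j, v = signed_row u' j by exists j.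
  by exists k => //; rewrite mem_enum.
move/perm_size; rewrite (size_map (signed_row u)) (size_map (signed_row u')) -!cardT.
rewrite !card_prod !card_ord card_bool !muln2.
exact: double_inj.
Qed.

Theorem theorem1p3 (R : realType) (P : set 'rV[R]_4)
    (P_o : polytope_o P) (P_gen : general_position 4 P)
    (P_centered : centroid P = 0) :
  X_functional 3 P / volume P <= (72%:R / 125%:R) `^ (4%:R^-1) /\
  (X_functional 3 P / volume P = (72%:R / 125%:R) `^ (4%:R^-1) <->
   exists u : 'I_5 -> 'rV[R]_4,
     normal_lines P u /\
     forall i, cone_volume_pm P (u i) = volume P / 5%:R).
Proof.
have [N [u [Pu u_free]]] := P_gen.
have V0 := volume_polytope_gt0 P_o.
have c0 : 0 <= 72%:R / 125%:R :> R by rewrite divr_ge0.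
have S0 := X3_sum_ge0 P u.
have [le eq] := three_distinct_le (cone_volume_pm_ge0 P u) V0 (sum_cone_volume_pm_le P_o Pu).
have Sle := X3_sum_le P u_free.
have XE := X_functionalE Pu.
have X0 : 0 <= X_functional 3 P by rewrite XE powR_ge0.
have X4 : X_functional 3 P ^+ 4 = X3_sum P u by rewrite XE root4K.
have V4 : 0 < volume P ^+ 4 by rewrite exprn_gt0.
split.
  rewrite -(@ler_pXn2r _ 4)// ?nnegrE ?powR_ge0 ?divr_ge0 ?(ltW V0)//.
  by rewrite root4K// expr_div_n X4 ler_pdivrMr// (le_trans Sle).
(* Both sides are nonnegative, so the equality may be tested on fourth powers. *)
have XSE : X_functional 3 P / volume P = (72%:R / 125%:R) `^ (4%:R^-1) <->
    X3_sum P u = 72%:R / 125%:R * volume P ^+ 4.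
  rewrite -X4; split=> [e|e].
    rewrite -[X in X * _](root4K c0) -e -exprMn mulfVK// gt_eqF//.
  apply/eqP; rewrite -(@eqrXn2 _ 4)// ?divr_ge0 ?powR_ge0 ?(ltW V0)//.
  by rewrite root4K// expr_div_n e mulfK// gt_eqF.
rewrite XSE; split=> [Se|[u' [Pu' u'V]]].
  (* Equality for [X3_sum] forces equality in the weight bound, whose equality case needs all
     weights positive. *)
  have [||] := eq.
  - by apply/eqP; rewrite eq_le le -Se.
  - exact: cone_volume_pm_gt0 P_o Pu.
  rewrite card_ord => N5; subst N => aV.
  by exists u.
(* Conversely [N = 5] supplies the fourth line needed for [X3_sum_eq]. Each [u i] is some [u' j] up
   to sign, so all weights equal [volume P / 5]. *)
have N5 := normal_lines_card Pu Pu'.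
rewrite X3_sum_eq ?N5//.
rewrite -(@three_distinct_uniform R 'I_N); last by rewrite card_ord.
congr three_distinct; apply/funext => i.
have : (facet_normals P `|` facet_normals (opp_set P)) (u i).
  by apply/(signed_rowP Pu); exists (i, false); rewrite /signed_row expr0 scale1r.
have [_ _ ->] := Pu' => -[j [->|->]]; first exact: u'V.
by rewrite /cone_volume_pm opprK addrC; exact: u'V.
Qed.
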